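(* Let $d\ge 2$, $n\ge 2$, let $\mathcal G=(\mathcal V,\mathcal E)$ be an undirected graph with $\mathcal V=\{1,\dots,n\}$ and $m$ edges, and consider $n$ agents with $\dot p_i=v_i$, $\dot v_i=u_i$ for $i=1,\dots,n$, where $p_i(t),v_i(t),u_i(t)\in\mathbb R^d$. Assume that $p_i(t)$, $v_i(t)$, $u_i(t)$ are bounded over $t\ge 0$ for every $i\in\mathcal V$, that all bearings $g_{ij}(t)$, $(i,j)\in\mathcal E$, are well defined for all $t\ge 0$ (i.e. $p_i(t)\ne p_j(t)$), and that the formation $\mathcal G(\boldsymbol p(t))$ is bearing persistently exciting (BPE). Agent $1$ is the leader, whose position $p_1$ is measured. Write the system in stacked form as $$\begin{bmatrix}\dot{\boldsymbol p}\\ \dot{\boldsymbol v}\end{bmatrix}=A\begin{bmatrix}\boldsymbol p\\ \boldsymbol v\end{bmatrix}+B\boldsymbol u,\qquad \boldsymbol y=C(t)\begin{bmatrix}\boldsymbol p\\ \boldsymbol v\end{bmatrix},$$ with $A=\begin{bmatrix}0_{dn} & I_{dn}\\ 0_{dn} & 0_{dn}\end{bmatrix}$, $B=\begin{bmatrix}0_{dn}\\ I_{dn}\end{bmatrix}$, $C(t)=\begin{bmatrix}L_B(\boldsymbol p(t))+C_1&0_{dn}\end{bmatrix}\in\mathbb R^{dn\times 2dn}$, and $C_1=\mathrm{blkdiag}(I_d,0_d,\dots,0_d)\in\mathbb R^{dn\times dn}$. Let $Q\in\mathbb R^{dn\times dn}$ and $S\in\mathbb R^{2dn\times 2dn}$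 be constant symmetric positive definite matrices, let $\kappa\ge\frac12$, and let $M(t)$ be the solution of the continuous Riccati equation $$\dot M=AM+MA^\top-MC^\top QCM+S,\qquad M(0)=I_{2dn}.$$ Let the estimates $\hat{\boldsymbol p}=[\hat p_1^\top,\dots,\hat p_n^\top]^\top$, $\hat{\boldsymbol v}=[\hat v_1^\top,\dots,\hat v_n^\top]^\top$ satisfy $$\begin{bmatrix}\dot{\hat{\boldsymbol p}}\\ \dot{\hat{\boldsymbol v}}\end{bmatrix}=A\begin{bmatrix}\hat{\boldsymbol p}\\ \hat{\boldsymbol v}\end{bmatrix}+B\boldsymbol u+K\left(\boldsymbol y-C\begin{bmatrix}\hat{\boldsymbol p}\\ \hat{\boldsymbol v}\end{bmatrix}\right),\qquad K(t)=\kappa M(t)C(t)^\top Q .$$ Then the origin of the estimation error $\boldsymbol\delta:=\big((\hat{\boldsymbol p}-\boldsymbol p)^\top,(\hat{\boldsymbol v}-\boldsymbol v)^\top\big)^\top$ is globally exponentially stable.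
   Context: Notation: $\boldsymbol p=[p_1^\top,\dots,p_n^\top]^\top$, $\boldsymbol v=[v_1^\top,\dots,v_n^\top]^\top$, $\boldsymbol u=[u_1^\top,\dots,u_n^\top]^\top\in\mathbb R^{dn}$; $I_k$ and $0_k$ are the $k\times k$ identity and zero matrices. For matrices, $X\ge Y$ means $X-Y$ is positive semidefinite. For $y\in S^{d-1}$ (the unit sphere in $\mathbb R^d$), $\pi_y:=I_d-yy^\top$. Bearings: for $(i,j)\in\mathcal E$, $p_{ij}:=p_j-p_i$ and, if $p_{ij}\ne0$, $g_{ij}:=p_{ij}/\|p_{ij}\|$. Fix an arbitrary orientation of the edges and number them $k=1,\dots,m$; if edge $k$ goes from $i$ to $j$, set $\bar p_k:=p_{ij}$ and $\bar g_k:=\bar p_k/\|\bar p_k\|$. Let $H\in\mathbb R^{m\times n}$ be the incidence matrix of the oriented graph (row $k$ has $-1$ in column $i$, $+1$ in column $j$, zeros elsewhere), $\bar H:=H\otimes I_d$, $L:=\bar H^\top\bar H$ the graph Laplacian, and $$L_B(\boldsymbol p):=\bar H^\top\,\Pi\,\bar H,\qquad \Pi=\mathrm{blkdiag}(\pi_{\bar g_1},\dots,\pi_{\bar g_m})$$ the bearing Laplacian. BPE: the formation $\mathcal G(\boldsymbol p(t))$ is bearing persistently exciting (BPE) if $\mathcal G$ is connected and there exist $T>0$, $\mu>0$ such that for all $t\ge0$, $\frac1T\int_t^{t+T}L_B(\boldsymbol p(\tau))\,d\tau\ge\mu L$. Global exponential stability of the origin of the error means: there are constants $c,\lambda>0$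 such that $\|\boldsymbol\delta(t)\|\le c\,e^{-\lambda(t-t_0)}\|\boldsymbol\delta(t_0)\|$ for all $t\ge t_0\ge0$ and all initial errors. *)

(* Defs.v *)
From mathcomp Require Export all_boot all_order all_algebra.
From mathcomp Require Export mxtens.
From mathcomp Require Export all_classical all_reals all_analysis.
Export Order.TTheory GRing.Theory Num.Theory.
Export numFieldNormedType.Exports.

Set Implicit Arguments.
Unset Strict Implicit.
Unset Printing Implicit Defensive.

Local Open Scope classical_set_scope.
Local Open Scope ring_scope.

Section LinearAlgebra.
Context {R : realType}.

(* The norm provided by the library on column vectors is the sup norm. *)
Definition enorm k (x : 'cV[R]_k) : R := Num.sqrt (\sum_i x i 0 ^+ 2).

Definition psdmx k (X : 'M[R]_k) : Prop :=
  X^T = X /\ forall x : 'cV[R]_k, 0 <= (x^T *m X *m x) 0 0.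

Definition pdmx k (X : 'M[R]_k) : Prop :=
  X^T = X /\ forall x : 'cV[R]_k, x != 0 -> 0 < (x^T *m X *m x) 0 0.

Definition loewner_ge k (X Y : 'M[R]_k) : Prop := psdmx (X - Y).

(* Coordinate a of block i sits at position i * d + a, the convention of the
   Kronecker product *t. *)
Definition stack n d (x : 'I_n -> 'cV[R]_d) : 'cV[R]_(n * d) :=
  \col_k x (mxtens_unindex k).1 (mxtens_unindex k).2 0.

Definition blkdiag n d (D : 'I_n -> 'M[R]_d) : 'M[R]_(n * d) :=
  \sum_(i < n) delta_mx i i *t D i.

Definition proj_orth d (y : 'cV[R]_d) : 'M[R]_d := 1%:M - y *m y^T.

End LinearAlgebra.

Section Calculus.
Context {R : realType}.

(* F, viewed as a function on [t0, +oo[, has derivative D at t: the two-sided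
   derivative when t0 < t, the right derivative when t = t0. *)
Definition deriv_from (t0 : R) a b (F : R -> 'M[R]_(a, b)) (t : R)
    (D : 'M[R]_(a, b)) : Prop :=
  (s - t)^-1 *: (F s - F t) @[s --> within `[t0, +oo[ t^'] --> D.

Definition mxintegral a b (t0 t1 : R) (F : R -> 'M[R]_(a, b)) : 'M[R]_(a, b) :=
  \matrix_(i, j) \int[lebesgue_measure]_(s in `[t0, t1]) F s i j.

Definition bounded_ge0 k (x : R -> 'cV[R]_k) : Prop :=
  exists b : R, forall t, 0 <= t -> enorm (x t) <= b.

(* traj t0 is the set of error trajectories issued from the initial time t0;
   only their values on [t0, +oo[ matter. *)
Definition globally_exponentially_stable k (traj : R -> set (R -> 'cV[R]_k)) :
    Prop :=
  exists c lambda : R, [/\ 0 < c, 0 < lambda &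
    forall (t0 : R) (delta : R -> 'cV[R]_k), 0 <= t0 -> traj t0 delta ->
      forall t, t0 <= t ->
        enorm (delta t) <= c * expR (- lambda * (t - t0)) * enorm (delta t0)].

End Calculus.

Definition simple_graph n (e : rel 'I_n) : Prop := symmetric e /\ irreflexive e.

(* The m edges are numbered by 'I_m, edge k being oriented from tl k to hd k:
   each edge {i, j} is listed exactly once, in one of its two directions. *)
Definition oriented_edges n m (e : rel 'I_n) (tl hd : 'I_m -> 'I_n) : Prop :=
  [/\ forall k, e (tl k) (hd k),
      injective (fun k => [set tl k; hd k]%SET) &
      forall i j, e i j -> exists k, [set tl k; hd k]%SET = [set i; j]%SET].

Definition graph_connected n (e : rel 'I_n) : Prop := forall i j, connect e i j.

Section Bearings.
Context {R : realType} (n m d : nat).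
Implicit Types (e : rel 'I_n) (tl hd : 'I_m -> 'I_n) (q : 'I_n -> 'cV[R]_d).

Definition incidence tl hd : 'M[R]_(m, n) :=
  \matrix_(k, i) ((i == hd k)%:R - (i == tl k)%:R).

Definition incidence_bar tl hd : 'M[R]_(m * d, n * d) :=
  incidence tl hd *t (1%:M : 'M[R]_d).

Definition laplacian tl hd : 'M[R]_(n * d) :=
  (incidence_bar tl hd)^T *m incidence_bar tl hd.

(* Only meaningful when q i != q j. *)
Definition bearing q (i j : 'I_n) : 'cV[R]_d :=
  (enorm (q j - q i))^-1 *: (q j - q i).

Definition bearing_laplacian tl hd q : 'M[R]_(n * d) :=
  (incidence_bar tl hd)^T
    *m blkdiag (fun k => proj_orth (bearing q (tl k) (hd k)))
    *m incidence_bar tl hd.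

Definition BPE e tl hd (p : 'I_n -> R -> 'cV[R]_d) : Prop :=
  graph_connected e /\
  exists T mu : R, [/\ 0 < T, 0 < mu &
    forall t, 0 <= t ->
      loewner_ge
        (T^-1 *: mxintegral t (t + T)
                   (fun s => bearing_laplacian tl hd (fun i => p i s)))
        (mu *: laplacian tl hd)].

End Bearings.

Section Observer.
Context {R : realType} (n m d : nat).
Variables (tl hd : 'I_m -> 'I_n) (p : 'I_n -> R -> 'cV[R]_d).

Definition sysA : 'M[R]_(n * d + n * d) := block_mx 0 1%:M 0 0.

Definition sysB : 'M[R]_(n * d + n * d, n * d) := col_mx 0 1%:M.

(* The leader is the agent of index 0. *)
Definition sysC1 : 'M[R]_(n * d) :=
  blkdiag (fun i : 'I_n => if val i == 0%N then 1%:M else 0).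

Definition sysC (t : R) : 'M[R]_(n * d, n * d + n * d) :=
  row_mx (bearing_laplacian tl hd (fun i => p i t) + sysC1) 0.

Definition riccati_solution (Q : 'M[R]_(n * d)) (S : 'M[R]_(n * d + n * d))
    (M : R -> 'M[R]_(n * d + n * d)) : Prop :=
  M 0 = 1%:M /\
  forall t, 0 <= t ->
    deriv_from 0 M t
      (sysA *m M t + M t *m sysA^T
       - M t *m (sysC t)^T *m Q *m sysC t *m M t + S).

Definition gain (kappa : R) (Q : 'M[R]_(n * d))
    (M : R -> 'M[R]_(n * d + n * d)) (t : R) : 'M[R]_(n * d + n * d, n * d) :=
  kappa *: (M t *m (sysC t)^T *m Q).

Definition observer_solution (K : R -> 'M[R]_(n * d + n * d, n * d))
    (v u : 'I_n -> R -> 'cV[R]_d) (t0 : R) (ph vh : 'I_n -> R -> 'cV[R]_d) :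
    Prop :=
  let x t := col_mx (stack (fun i => p i t)) (stack (fun i => v i t)) in
  let xh t := col_mx (stack (fun i => ph i t)) (stack (fun i => vh i t)) in
  let y t := sysC t *m x t in
  forall t, t0 <= t ->
    deriv_from t0 xh t
      (sysA *m xh t + sysB *m stack (fun i => u i t)
       + K t *m (y t - sysC t *m xh t)).

Definition estimation_error (v ph vh : 'I_n -> R -> 'cV[R]_d) (t : R) :
    'cV[R]_(n * d + n * d) :=
  col_mx (stack (fun i => ph i t) - stack (fun i => p i t))
         (stack (fun i => vh i t) - stack (fun i => v i t)).

End Observer.

(* Main.v *)
(** With [D = C^T Q C], the error solves [x' = (A - kappa M D) x], and
    [V = x^T M^-1 x] satisfies [V' <= - (M^-1 x)^T S (M^-1 x)] as soon as
    [kappa >= 1/2].  Everything thus rests on bounds [l <= M(t) <= m] that are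
    uniform in [t].

    Lower bound: for small [l], [X = M - l] solves [X' = F X + X F^T + Y] with
    [Y] positive definite, and [X (t + h)] equals
    [(1 + h F) X (1 + h F)^T + h Y] up to [o(h)], so [X >= 0] propagates.

    Upper bound: if [y' = - A^T y + D z], completing the square gives
    [(y^T M y)' <= y^T S y + z^T D z], whatever the function [z].  As [A^2 = 0],
    the minimal energy control [z = (1 + (t - t0) A) c] steers [y] from [0] to
    any prescribed value in a fixed time with energy controlled by the
    observability Gramian, so no differential equation has to be solved.

    Uniform coercivity of the Gramian: for [z(t) = x1 + (t - t0) x2], persistent
    excitation bounds the integral of [|P z|^2] from below on any window where
    [z] is large compared with its slope [x2], and one of two windows that are
    far enough apart has this property. *)

Require Import Defs.
From mathcomp Require Import ring lra.

Set Implicit Arguments.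
Unset Strict Implicit.
Unset Printing Implicit Defensive.

Local Open Scope classical_set_scope.
Local Open Scope ring_scope.

(** * One-sided derivatives on a half-line *)

Section ScalarDerivative.
Context {R : realType}.
Implicit Types (f g : R -> R) (t : R).

(** Scalar counterpart of [deriv_from], which [deriv_fromP] reduces to it entry by entry. *)
Definition rderiv (t0 : R) f t (l : R) : Prop :=
  (s - t)^-1 * (f s - f t) @[s --> within `[t0, +oo[ t^'] --> l.

Definition cont_from (t0 : R) f : Prop :=
  forall t, t0 <= t -> f s @[s --> within `[t0, +oo[ (nbhs t)] --> f t.

Lemma near_cvg (T : Type) (F : set_system T) (f g : T -> R) (l : R) : Filter F ->
  (\forall x \near F, f x = g x) -> f x @[x --> F] --> l -> g x @[x --> F] --> l.
Proof.
move=> FF e h; apply/cvgrPdist_lt => eps eps0; move/cvgrPdist_lt : h => /(_ _ eps0).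
by apply: filterS2 e => x ->.
Qed.

Lemma rderiv_cst t0 c t : rderiv t0 (fun=> c) t 0.
Proof.
rewrite /rderiv (_ : (fun s => _) = fun=> 0); first exact: cvg_cst.
by apply/funext => s; rewrite subrr mulr0.
Qed.

Lemma rderivD t0 f g t a b :
  rderiv t0 f t a -> rderiv t0 g t b -> rderiv t0 (fun s => f s + g s) t (a + b).
Proof.
move=> ha hb; rewrite /rderiv; apply: near_cvg (cvgD ha hb).
by apply: nearW => s /=; ring.
Qed.

Lemma rderiv_sum t0 I (r : seq I) (F : I -> R -> R) t (D : I -> R) :
  (forall i, rderiv t0 (F i) t (D i)) ->
  rderiv t0 (fun s => \sum_(i <- r) F i s) t (\sum_(i <- r) D i).
Proof.
move=> h; elim: r => [|i r IH].
  rewrite big_nil (_ : (fun s => _) = fun=> 0); first exact: rderiv_cst.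
  by apply/funext => s; rewrite big_nil.
rewrite big_cons (_ : (fun s => _) = fun s => F i s + \sum_(i <- r) F i s).
  exact: rderivD.
by apply/funext => s; rewrite big_cons.
Qed.

Lemma rderiv_cvg t0 f t l :
  rderiv t0 f t l -> f s @[s --> within `[t0, +oo[ t^'] --> f t.
Proof.
move=> h.
have hid : (s - t) @[s --> within `[t0, +oo[ t^'] --> (0 : R).
  apply: cvg_within_filter; apply: cvg_within_filter.
  have : (s - t) @[s --> t] --> t - t by apply: cvgB; [exact: cvg_id|exact: cvg_cst].
  by rewrite subrr.
have := cvgD (cvgM hid h) (cvg_cst (f t)).
rewrite mul0r add0r => /(_ _ _ _) H; apply: near_cvg H; rewrite near_withinE; near=> s => _ /=.
have st : s - t != 0 by rewrite subr_eq0; near: s; exact: nbhs_dnbhs_neq.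
by rewrite mulrA divff // mul1r subrK.
Unshelve. all: by end_near. Qed.

Lemma rderiv_near t0 f t l :
  rderiv t0 f t l -> f s @[s --> within `[t0, +oo[ (nbhs t)] --> f t.
Proof.
move=> /rderiv_cvg /cvgrPdist_lt h; apply/cvgrPdist_lt => e e0.
have := h e e0; rewrite !near_withinE => {}h.
have : \forall s \near nbhs t, s != t -> `[t0, +oo[%classic s -> `|f t - f s| < e by exact: h.
apply: filterS => s hs s0; have [->|/hs] := eqVneq s t; first by rewrite subrr normr0.
exact.
Qed.

Lemma rderivM t0 f g t a b :
  rderiv t0 f t a -> rderiv t0 g t b ->
  rderiv t0 (fun s => f s * g s) t (a * g t + f t * b).
Proof.
move=> ha hb; rewrite /rderiv.
apply: near_cvg (cvgD (cvgM ha (rderiv_cvg hb)) (cvgM (cvg_cst (f t)) hb)).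
by apply: nearW => s /=; ring.
Qed.

Lemma rderiv_id t0 t : rderiv t0 (fun s => s) t 1.
Proof.
apply: (@near_cvg _ _ (fun=> 1)); last exact: cvg_cst.
rewrite near_withinE; near=> s => _.
rewrite mulVf // subr_eq0; near: s; exact: nbhs_dnbhs_neq.
Unshelve. all: by end_near. Qed.

Lemma rderiv_sub t0 t1 f t l : t0 <= t1 -> rderiv t0 f t l -> rderiv t1 f t l.
Proof.
move=> h01 h A /h; rewrite /nbhs /= /fmap /within /=; apply: filterS => s hs st.
by apply: hs; move: st; rewrite /= !in_itv /= !andbT; exact: le_trans.
Qed.

(** Away from the endpoint [t0] the half-line is a neighbourhood of [t], so the restriction of the
    filter is harmless. *)
Lemma rderiv_is_derive t0 f t l : t0 < t -> rderiv t0 f t l -> is_derive t 1 f l.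
Proof.
move=> t0t h.
suff H : h0^-1 *: ((f \o shift t) (h0 *: (1:R)) - f t) @[h0 --> 0^'] --> l.
  split; first by apply/cvg_ex; exists l.
  exact/cvg_lim.
apply/cvgrPdist_lt => e e0; move/cvgrPdist_lt : h => /(_ e e0).
rewrite near_withinE => h.
have {}h : \forall s \near t, s != t ->
     `[t0, +oo[%classic s -> `|l - (s - t)^-1 * (f s - f t)| < e by exact: h.
have h' : \forall s \near (0:R), s != 0 -> t0 <= s + t ->
     `|l - s^-1 * (f (s + t) - f t)| < e.
  have := h; rewrite (near_shift 0 t) subr0; apply: filterS => s /= hs sn0 s0; have := hs.
  rewrite /= addrK; apply; first by rewrite -subr_eq0 addrK.
  by rewrite in_itv /= andbT.
have h2 : \forall s \near (0:R), t0 <= s + t.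
  have tt0 : 0 < t - t0 by rewrite subr_gt0.
  by apply: filterS (nbhs0_lt tt0) => s; rewrite ltr_norml => /andP[] *; lra.
rewrite /dnbhs /= near_withinE; apply: filterS2 h' h2 => s hs1 hs2 sn0 /=.
by rewrite scaler1; apply: hs1.
Qed.

Lemma is_derive_rderiv t0 f t l : is_derive t 1 f l -> rderiv t0 f t l.
Proof.
move=> [/cvg_ex[l' hl'] ll']; have -> : l = l' by rewrite -ll'; exact/cvg_lim.
apply/cvgrPdist_lt => e e0; move/cvgrPdist_lt : hl' => /(_ e e0) h.
have {}h : \forall s \near (0:R), s != 0 ->
    `|l' - s^-1 *: ((f \o shift t) (s *: (1:R)) - f t)| < e by exact: h.
rewrite near_withinE.
have h' : \forall s \near t, s != t -> `|l' - (s - t)^-1 * (f s - f t)| < e.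
  rewrite (near_shift 0 t) subr0; apply: filterS h => s /= hs sn.
  rewrite addrK; have := hs; rewrite scaler1 /=; apply.
  by rewrite -subr_eq0 addrK in sn.
by apply: filterS h' => s /= hs sn _; apply: hs.
Qed.

Lemma rderiv_itv_continuous t0 a b f f' : t0 <= a ->
  (forall s, a <= s <= b -> rderiv t0 f s (f' s)) ->
  {within `[a, b], continuous f}.
Proof.
move=> t0a h; apply/subspace_continuousP => s /=; rewrite in_itv /= => sab.
move=> A /(rderiv_near (h s sab)); rewrite /nbhs /= /fmap /within /=; apply: filterS => x hx; rewrite in_itv /= => /andP[ax _]; apply: hx.
by rewrite /= in_itv /= andbT (le_trans t0a).
Qed.

(** The mean value theorem asks for differentiability only inside the interval, so a merely right
    derivative at [a = t0] is enough. *)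
Lemma rderiv_MVT t0 a b f f' : t0 <= a -> a < b ->
  (forall s, a <= s <= b -> rderiv t0 f s (f' s)) ->
  exists2 c, a < c < b & f b - f a = f' c * (b - a).
Proof.
move=> t0a ab h.
have [||c] := @MVT R f f' a b ab.
- move=> x; rewrite in_itv /= => /andP[ax xb]; apply: (@rderiv_is_derive t0).
    exact: le_lt_trans ax.
  by apply: h; rewrite !ltW.
- exact: rderiv_itv_continuous h.
by rewrite in_itv /=; exists c.
Qed.

Lemma rderiv_growth t0 a b f f' k : t0 <= a -> a <= b ->
  (forall s, a <= s <= b -> rderiv t0 f s (f' s)) ->
  (forall s, a <= s <= b -> f' s <= k) -> f b - f a <= k * (b - a).
Proof.
move=> t0a; rewrite le_eqVlt => /predU1P[->|ab] h hk; first by rewrite !subrr mulr0.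
have [c /andP[ac cb] ->] := rderiv_MVT t0a ab h.
by rewrite ler_pM2r ?subr_gt0 //; apply: hk; rewrite !ltW.
Qed.

Lemma rderiv_growth_ge t0 a b f f' k : t0 <= a -> a <= b ->
  (forall s, a <= s <= b -> rderiv t0 f s (f' s)) ->
  (forall s, a <= s <= b -> k <= f' s) -> k * (b - a) <= f b - f a.
Proof.
move=> t0a; rewrite le_eqVlt => /predU1P[->|ab] h hk; first by rewrite !subrr mulr0.
have [c /andP[ac cb] ->] := rderiv_MVT t0a ab h.
by rewrite ler_pM2r ?subr_gt0 //; apply: hk; rewrite !ltW.
Qed.

Lemma rderiv_expR t0 k t : rderiv t0 (fun s => expR (k * s)) t (k * expR (k * t)).
Proof.
apply: is_derive_rderiv; rewrite mulrC.
apply: (@is_derive1_comp R expR (fun s => k * s)).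
have -> : (fun s => k * s) = k *: (id : R -> R) by [].
by apply: is_derive_eq; rewrite /GRing.scale /= mulr1.
Qed.

(** The product of [f] with [expR (- k * s)] has nonpositive derivative. *)
Lemma rderiv_gronwall t0 a b f f' k : t0 <= a -> a <= b ->
  (forall s, a <= s <= b -> rderiv t0 f s (f' s)) ->
  (forall s, a <= s <= b -> f' s <= k * f s) ->
  f b <= f a * expR (k * (b - a)).
Proof.
move=> t0a ab h hk.
have H s : a <= s <= b -> rderiv t0 (fun s => f s * expR ((- k) * s)) s
    (f' s * expR ((- k) * s) + f s * (- k * expR ((- k) * s))).
  by move=> sab; apply: rderivM; [exact: h|exact: rderiv_expR].
have := rderiv_growth (k := 0) t0a ab H.
rewrite mul0r subr_le0 => H'.
have {}H' : f b * expR (- k * b) <= f a * expR (- k * a).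
  apply: H' => s /hk hs; have := expR_gt0 (- k * s); nra.
have := ler_wpM2r (expR_ge0 (k * b)) H'.
have e1 : - k * b + k * b = 0 by ring.
have e2 : - k * a + k * b = k * (b - a) by ring.
by rewrite -!mulrA -!expRD e1 e2 expR0 mulr1.
Qed.

Lemma cont_from_itv a b f : 0 <= a -> cont_from 0 f -> {within `[a, b], continuous f}.
Proof.
move=> a0 h; apply/subspace_continuousP => s /=; rewrite in_itv /= => /andP[as_ sb].
move=> A /(h s (le_trans a0 as_)); rewrite /nbhs /= /fmap /within /=; apply: filterS => x hx; rewrite in_itv /= => /andP[ax _]; apply: hx.
by rewrite /= in_itv /= andbT (le_trans a0).
Qed.

Lemma cont_from_bounded f b : cont_from 0 f -> 0 <= b ->
  exists k, forall s, 0 <= s <= b -> `|f s| <= k.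
Proof.
move=> cf b0.
have [c _ hc] := EVT_max b0 (cont_from_itv (lexx 0) cf).
have [c' _ hc'] := EVT_min b0 (cont_from_itv (lexx 0) cf).
exists (`|f c| + `|f c'|) => s sb.
have s' : s \in `[0, b] by rewrite in_itv.
move: (hc s s') (hc' s s') => h1 h2.
have := ler_norm (f c); have := ler_norm (- f c'); rewrite normrN => h3 h4.
have := normr_ge0 (f c); have := normr_ge0 (f c') => h5 h6.
rewrite ler_norml; apply/andP; split; lra.
Qed.

Lemma primitive_from0 f : cont_from 0 f ->
  exists F, forall t, 0 <= t -> rderiv 0 F t (f t).
Proof.
(* Freezing [f] at its value in 0 on the negative axis gives a function that is continuous on the
   whole line. *)
move=> cf; pose g s := f (Num.max 0 s).
have cg : continuous g.
  move=> t; have m0 : 0 <= Num.max 0 t :> R by rewrite le_max lexx.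
  have cm : Num.max 0 s @[s --> t] --> Num.max 0 t.
    by apply: (@continuous_max R R (fun=> 0) id t); [exact: cvg_cst|exact: cvg_id].
  move=> A /(cf _ m0) h; change (nbhs t (g @^-1` A)).
  have h2 : nbhs t _ := cm _ h.
  by apply: filterS h2 => s /=; apply; rewrite in_itv /= andbT le_max lexx.
(* Integrating from -1 makes [t = 0] an interior point, where the fundamental theorem still
   applies. *)
exists (fun t => \int[lebesgue_measure]_(s in `[-1, t]) g s) => t t0.
apply: is_derive_rderiv.
have ig : lebesgue_measure.-integrable `[-1, (t + 1)] (EFin \o g).
  apply: continuous_compact_integrable; first exact: segment_compact.
  exact: continuous_subspaceT.
have t1 : t < t + 1 by rewrite ltrDl.
have t1' : -1 < t by apply: lt_le_trans t0; rewrite oppr_lt0.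
have [d1 d2] := continuous_FTC1_closed t1 ig t1' (cg t).
split => //; rewrite -derive1E d2 /g; congr f.
by apply/max_idPr.
Qed.

Lemma FTC2_from0 f F a b : 0 <= a -> a < b -> cont_from 0 f ->
  (forall t, 0 <= t -> rderiv 0 F t (f t)) ->
  \int[lebesgue_measure]_(s in `[a, b]) f s = F b - F a.
Proof.
move=> a0 ab cf dF.
have cF : {within `[a, b], continuous F}.
  by apply: (@rderiv_itv_continuous 0 _ _ _ f) => // s /andP[as_ _]; apply: dF; lra.
rewrite /Rintegral (@continuous_FTC2 _ f F a b) //.
- exact: cont_from_itv.
- have /(continuous_within_itvP _ ab)[_ h1 h2] := cF; split => //.
  move=> x; rewrite in_itv /= => /andP[ax xb].
  have x0 : 0 < x by lra.
  by have [] := rderiv_is_derive x0 (dF x (ltW x0)).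
- move=> x; rewrite in_itv /= => /andP[ax xb].
  have x0 : 0 < x by lra.
  have H := rderiv_is_derive x0 (dF x (ltW x0)).
  by rewrite derive1E derive_val.
Qed.

End ScalarDerivative.

(** * Derivatives and limits of matrix-valued functions, entry by entry *)

Section MatrixDerivative.
Context {R : realType}.

Lemma cvg_mxP T (F : set_system T) a b (f : T -> 'M[R]_(a, b)) (D : 'M[R]_(a, b)) :
  Filter F ->
  (f x @[x --> F] --> D) <-> (forall i j, f x i j @[x --> F] --> D i j).
Proof.
move=> FF; split=> h.
  move=> i j; apply/cvg_ballP => e e0.
  by have /cvg_ballP /(_ e e0) := h; apply: filterS => x /= [_]; exact.
apply/cvg_ballP => e e0.
have H : \forall x \near F, forall i j, ball (D i j) e (f x i j).
  apply: filter_forall => i; apply: filter_forall => j.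
  by have /cvg_ballP := h i j; apply.
by apply: filterS H => x hx; split.
Qed.

Lemma deriv_fromP (t0 : R) a b (F : R -> 'M[R]_(a, b)) t D :
  deriv_from t0 F t D <-> forall i j, rderiv t0 (fun s => F s i j) t (D i j).
Proof.
rewrite /deriv_from cvg_mxP /rderiv; split=> h i j; have := h i j; apply: near_cvg;
  by apply: nearW => s; rewrite !mxE.
Qed.

Lemma deriv_from_cst (t0 : R) a b (A : 'M[R]_(a, b)) t : deriv_from t0 (fun=> A) t 0.
Proof. by apply/deriv_fromP => i j; rewrite mxE; exact: rderiv_cst. Qed.

Lemma deriv_fromD (t0 : R) a b (F G : R -> 'M[R]_(a, b)) t A B :
  deriv_from t0 F t A -> deriv_from t0 G t B ->
  deriv_from t0 (fun s => F s + G s) t (A + B).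
Proof.
move=> /deriv_fromP hA /deriv_fromP hB; apply/deriv_fromP => i j; rewrite mxE.
rewrite (_ : (fun s => _) = fun s => F s i j + G s i j); first exact: rderivD.
by apply/funext => s; rewrite mxE.
Qed.

Lemma deriv_fromM (t0 : R) a b c (F : R -> 'M[R]_(a, b)) (G : R -> 'M[R]_(b, c)) t A B :
  deriv_from t0 F t A -> deriv_from t0 G t B ->
  deriv_from t0 (fun s => F s *m G s) t (A *m G t + F t *m B).
Proof.
move=> /deriv_fromP hA /deriv_fromP hB; apply/deriv_fromP => i j.
rewrite !mxE -big_split /=.
rewrite (_ : (fun s => _) = fun s => \sum_j0 F s i j0 * G s j0 j).
  by apply: rderiv_sum => l; exact: rderivM.
by apply/funext => s; rewrite mxE.
Qed.

Lemma deriv_fromMl (t0 : R) a b c (A : 'M[R]_(a, b)) (G : R -> 'M[R]_(b, c)) t B :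
  deriv_from t0 G t B -> deriv_from t0 (fun s => A *m G s) t (A *m B).
Proof.
by move=> h; have := deriv_fromM (deriv_from_cst t0 A t) h; rewrite mul0mx add0r.
Qed.

Lemma deriv_fromMr (t0 : R) a b c (F : R -> 'M[R]_(a, b)) (A : 'M[R]_(b, c)) t B :
  deriv_from t0 F t B -> deriv_from t0 (fun s => F s *m A) t (B *m A).
Proof.
by move=> h; have := deriv_fromM h (deriv_from_cst t0 A t); rewrite mulmx0 addr0.
Qed.

Lemma deriv_fromZ (t0 : R) a b (k : R -> R) (F : R -> 'M[R]_(a, b)) t l A :
  rderiv t0 k t l -> deriv_from t0 F t A ->
  deriv_from t0 (fun s => k s *: F s) t (l *: F t + k t *: A).
Proof.
move=> hk /deriv_fromP hA; apply/deriv_fromP => i j; rewrite !mxE.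
rewrite (_ : (fun s => _) = fun s => k s * F s i j); first exact: rderivM.
by apply/funext => s; rewrite mxE.
Qed.

Lemma deriv_fromN (t0 : R) a b (F : R -> 'M[R]_(a, b)) t A :
  deriv_from t0 F t A -> deriv_from t0 (fun s => - F s) t (- A).
Proof.
move=> h; have := deriv_fromZ (rderiv_cst t0 (-1) t) h.
rewrite scale0r add0r scaleN1r.
by rewrite (_ : (fun s => -1 *: F s) = (fun s => - F s)) //; apply/funext => s; rewrite scaleN1r.
Qed.

Lemma deriv_fromB (t0 : R) a b (F G : R -> 'M[R]_(a, b)) t A B :
  deriv_from t0 F t A -> deriv_from t0 G t B ->
  deriv_from t0 (fun s => F s - G s) t (A - B).
Proof. by move=> hA hB; apply: deriv_fromD hA (deriv_fromN hB). Qed.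

Lemma deriv_from_tr (t0 : R) a b (F : R -> 'M[R]_(a, b)) t A :
  deriv_from t0 F t A -> deriv_from t0 (fun s => (F s)^T) t A^T.
Proof.
move=> /deriv_fromP hA; apply/deriv_fromP => i j; rewrite mxE.
rewrite (_ : (fun s => _) = fun s => F s j i); first exact: hA.
by apply/funext => s; rewrite mxE.
Qed.

Lemma deriv_from_sub (t0 t1 : R) a b (F : R -> 'M[R]_(a, b)) t A :
  t0 <= t1 -> deriv_from t0 F t A -> deriv_from t1 F t A.
Proof.
by move=> h /deriv_fromP hA; apply/deriv_fromP => i j; exact: rderiv_sub (hA i j).
Qed.

Lemma deriv_from_affine (t0 : R) a b (A B : 'M[R]_(a, b)) (c t : R) :
  deriv_from t0 (fun s => A + (s - c) *: B) t B.
Proof.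
have h1 : rderiv t0 (fun s => s - c) t (1 + 0).
  exact: rderivD (rderiv_id t0 t) (rderiv_cst t0 (- c) t).
have := deriv_fromD (deriv_from_cst t0 A t) (deriv_fromZ h1 (deriv_from_cst t0 B t)).
by rewrite addr0 scale1r scaler0 add0r addr0.
Qed.

Lemma deriv_from_cvg (t0 : R) a b (F : R -> 'M[R]_(a, b)) t A :
  deriv_from t0 F t A -> F s @[s --> within `[t0, +oo[ t^'] --> F t.
Proof.
by move=> /deriv_fromP hA; apply/cvg_mxP => i j; exact: rderiv_cvg (hA i j).
Qed.

Lemma deriv_from_cont (t0 : R) a b (F : R -> 'M[R]_(a, b)) (F' : R -> 'M[R]_(a, b)) i j :
  (forall t, t0 <= t -> deriv_from t0 F t (F' t)) ->
  cont_from t0 (fun s => F s i j).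
Proof. by move=> h t /h /deriv_fromP /(_ i j) /rderiv_near. Qed.

Lemma cvg_mulmx T (F : set_system T) a b c (f : T -> 'M[R]_(a, b)) (g : T -> 'M[R]_(b, c)) (A : 'M[R]_(a, b)) (B : 'M[R]_(b, c)) :
  Filter F -> f x @[x --> F] --> A -> g x @[x --> F] --> B ->
  f x *m g x @[x --> F] --> A *m B.
Proof.
move=> FF /cvg_mxP hA /cvg_mxP hB; apply/cvg_mxP => i j; rewrite mxE.
apply: (@near_cvg _ _ _ (fun x => \sum_j0 f x i j0 * g x j0 j)); first by apply: nearW => x; rewrite mxE.
elim: (index_enum _) => [|l r IH].
  rewrite big_nil (_ : (fun _ => _) = fun=> 0); first exact: cvg_cst.
  by apply/funext => x; rewrite big_nil.
rewrite big_cons (_ : (fun _ => _) = fun x => f x i l * g x l j + \sum_(j0 <- r) f x i j0 * g x j0 j).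
  by apply: cvgD => //; apply: cvgM; [exact: hA|exact: hB].
by apply/funext => x; rewrite big_cons.
Qed.

End MatrixDerivative.

(** * Quadratic forms *)

Section MatrixEntries.
Context {R : pzRingType} {a b : nat}.
Implicit Types X Y : 'M[R]_(a, b).

Lemma mxDE X Y i j : (X + Y) i j = X i j + Y i j. Proof. by rewrite mxE. Qed.
Lemma mxNE X i j : (- X) i j = - X i j. Proof. by rewrite mxE. Qed.
Lemma mxZE c X i j : (c *: X) i j = c * X i j. Proof. by rewrite mxE. Qed.
Lemma mxtrD X Y : (X + Y)^T = X^T + Y^T. Proof. exact: linearD. Qed.
Lemma mxtrN X : (- X)^T = - X^T. Proof. exact: linearN. Qed.
Lemma mxtrZ c X : (c *: X)^T = c *: X^T. Proof. exact: linearZ. Qed.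

End MatrixEntries.

Lemma mxME (R : pzRingType) a b c (X : 'M[R]_(a, b)) (Y : 'M[R]_(b, c)) i j :
  (X *m Y) i j = \sum_l X i l * Y l j.
Proof. by rewrite mxE. Qed.

Lemma mxTE (R : Type) a b (X : 'M[R]_(a, b)) i j : X^T i j = X j i.
Proof. by rewrite mxE. Qed.

(* Proves identities that hold in every left module, matrix products being atoms. *)
Ltac mxmodule := apply/matrixP => ? ?; rewrite ?(mxDE, mxNE, mxZE); ring.

Section QuadraticForms.
Context {R : realType}.

Definition dot k (x y : 'cV[R]_k) : R := (x^T *m y) 0 0.

Lemma dotE k (x y : 'cV[R]_k) : dot x y = \sum_i x i 0 * y i 0.
Proof. by rewrite /dot mxE; apply: eq_bigr => i _; rewrite mxE. Qed.

Lemma dotC k (x y : 'cV[R]_k) : dot x y = dot y x.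
Proof. by rewrite !dotE; apply: eq_bigr => i _; rewrite mulrC. Qed.

Lemma dotDr k (x y z : 'cV[R]_k) : dot x (y + z) = dot x y + dot x z.
Proof. by rewrite /dot mulmxDr mxE. Qed.

Lemma dotNr k (x y : 'cV[R]_k) : dot x (- y) = - dot x y.
Proof. by rewrite /dot mulmxN mxE. Qed.

Lemma dotBr k (x y z : 'cV[R]_k) : dot x (y - z) = dot x y - dot x z.
Proof. by rewrite dotDr dotNr. Qed.

Lemma dotZr k (x y : 'cV[R]_k) c : dot x (c *: y) = c * dot x y.
Proof. by rewrite /dot -scalemxAr mxE. Qed.

Lemma dotDl k (x y z : 'cV[R]_k) : dot (x + y) z = dot x z + dot y z.
Proof. by rewrite dotC dotDr !(dotC z). Qed.

Lemma dotNl k (x y : 'cV[R]_k) : dot (- x) y = - dot x y.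
Proof. by rewrite dotC dotNr dotC. Qed.

Lemma dotBl k (x y z : 'cV[R]_k) : dot (x - y) z = dot x z - dot y z.
Proof. by rewrite dotDl dotNl. Qed.

Lemma dotZl k (x y : 'cV[R]_k) c : dot (c *: x) y = c * dot x y.
Proof. by rewrite dotC dotZr dotC. Qed.

Lemma dot0r k (x : 'cV[R]_k) : dot x 0 = 0.
Proof. by rewrite /dot mulmx0 mxE. Qed.

Lemma dot_mul a b (x : 'cV[R]_a) (X : 'M[R]_(a, b)) y : dot x (X *m y) = dot (X^T *m x) y.
Proof. by rewrite /dot trmx_mul trmxK mulmxA. Qed.

Lemma dot_mulT a b (x : 'cV[R]_b) (X : 'M[R]_(a, b)) y : dot x (X^T *m y) = dot (X *m x) y.
Proof. by rewrite dot_mul trmxK. Qed.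

Lemma quadE k (X : 'M[R]_k) x : (x^T *m X *m x) 0 0 = dot x (X *m x).
Proof. by rewrite /dot mulmxA. Qed.

Lemma dot_ge0 k (x : 'cV[R]_k) : 0 <= dot x x.
Proof. by rewrite dotE; apply: sumr_ge0 => i _; rewrite -expr2 sqr_ge0. Qed.

Lemma dot_eq0 k (x : 'cV[R]_k) : dot x x = 0 -> x = 0.
Proof.
rewrite dotE => /eqP; rewrite psumr_eq0 => [/allP h|i _]; last by rewrite -expr2 sqr_ge0.
apply/colP => i; rewrite mxE; have := h i (mem_index_enum i).
by rewrite /= mulf_eq0 orbb => /eqP.
Qed.

Lemma dot_gt0 k (x : 'cV[R]_k) : x != 0 -> 0 < dot x x.
Proof.
move=> x0; rewrite lt_def dot_ge0 andbT; apply: contra x0 => /eqP /dot_eq0 ->; exact: eqxx.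
Qed.

Lemma enormE k (x : 'cV[R]_k) : enorm x = Num.sqrt (dot x x).
Proof. by rewrite /enorm dotE; congr Num.sqrt; apply: eq_bigr => i _; rewrite expr2. Qed.

Lemma discriminant_le (A B C : R) : 0 <= C ->
  (forall t, 0 <= A + 2 * t * B + t ^+ 2 * C) -> B ^+ 2 <= A * C.
Proof.
rewrite le_eqVlt => /predU1P[<-|C0] h.
  rewrite mulr0; have [->|B0] := eqVneq B 0; first by rewrite expr0n.
  (* When [C = 0] and [B] is nonzero, the affine function would take the value -1 at this point. *)
  have := h (- (A + 1) / (2 * B)).
  rewrite (_ : _ + _ = -1); last by field.
  by rewrite oppr_ge0 ler10.
(* The minimiser of the quadratic polynomial. *)
have := h (- B / C); rewrite (_ : _ + _ = A - B ^+ 2 / C); last first.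
  by field; rewrite lt0r_neq0.
by rewrite subr_ge0 ler_pdivrMr.
Qed.

Definition psd_form k (X : 'M[R]_k) := forall x, 0 <= dot x (X *m x).

Lemma psd_CS k (X : 'M[R]_k) x y : X^T = X -> psd_form X ->
  dot x (X *m y) ^+ 2 <= dot x (X *m x) * dot y (X *m y).
Proof.
move=> sX pX; apply: discriminant_le => // t.
have := pX (x + t *: y).
rewrite mulmxDr -scalemxAr !dotDr !dotDl !dotZr !dotZl.
have -> : dot y (X *m x) = dot x (X *m y) by rewrite dot_mul sX dotC.
set a := dot x _; set b := dot x _; set c := dot y _.
by rewrite (_ : a + t * b + (t * b + t * (t * c)) = a + 2 * t * b + t ^+ 2 * c) //; ring.
Qed.

Lemma dot_CS k (x y : 'cV[R]_k) : dot x y ^+ 2 <= dot x x * dot y y.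
Proof.
have := @psd_CS k 1%:M x y; rewrite !mul1mx; apply; first exact: trmx1.
by move=> z; rewrite mul1mx dot_ge0.
Qed.

Definition entries_le a b (X : 'M[R]_(a, b)) (c : R) := forall i j, `|X i j| <= c.

(** Each term satisfies [|x_i X_ij y_j| <= c (x_i^2 + y_j^2)]. The constant is not sharp; only its
    independence of [x] and [y] matters. *)
Lemma form_bound k (X : 'M[R]_k) c x y : 0 <= c -> entries_le X c ->
  `|dot x (X *m y)| <= c * k%:R * (dot x x + dot y y).
Proof.
move=> c0 hX.
have -> : dot x (X *m y) = \sum_i \sum_j x i 0 * X i j * y j 0.
  rewrite dotE; apply: eq_bigr => i _; rewrite mxE mulr_sumr.
  by apply: eq_bigr => j _; rewrite mulrA.
have -> : c * k%:R * (dot x x + dot y y) =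
    \sum_(i < k) \sum_(j < k) c * (x i 0 ^+ 2 + y j 0 ^+ 2).
  under eq_bigr do rewrite -mulr_sumr big_split /= sumr_const card_ord.
  rewrite -mulr_sumr big_split /= sumr_const card_ord sumrMnl !dotE.
  under [X in _ = c * (_ + X *+ _)]eq_bigr do rewrite expr2.
  under [X in _ = c * (X *+ _ + _)]eq_bigr do rewrite expr2.
  by rewrite -mulrnDl -mulrA [_%:R * _]mulr_natl.
apply: le_trans (ler_norm_sum _ _ _) _; apply: ler_sum => i _.
apply: le_trans (ler_norm_sum _ _ _) _; apply: ler_sum => j _.
rewrite !normrM.
have := hX i j; have := normr_ge0 (x i 0); have := normr_ge0 (y j 0).
rewrite -(real_normK (num_real (x i 0))) -(real_normK (num_real (y j 0))).
set p := `|x i 0|; set q := `|y j 0|; set r := `|X i j| => q0 p0 hr.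
have : r * (p * q) <= c * (p * q) by apply: ler_wpM2r => //; exact: mulr_ge0.
have : p * q <= p ^+ 2 + q ^+ 2 by nra.
move=> /(ler_wpM2l c0); nra.
Qed.

Lemma mul_bound a b (X : 'M[R]_(a, b)) c : entries_le X c ->
  forall x, dot (X *m x) (X *m x) <= c ^+ 2 * (a * b)%:R * dot x x.
Proof.
move=> hX x; rewrite [leLHS]dotE.
have H i : (X *m x) i 0 * (X *m x) i 0 <= c ^+ 2 *+ b * dot x x.
  have -> : (X *m x) i 0 = dot (row i X)^T x.
    by rewrite dotE mxE; apply: eq_bigr => j _; rewrite !mxE.
  rewrite -expr2; apply: le_trans (dot_CS _ _) _; apply: ler_wpM2r; first exact: dot_ge0.
  rewrite dotE -[X in _ *+ X]card_ord -sumr_const; apply: ler_sum => j _.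
  by rewrite !mxE -expr2 -real_normK ?num_real // lerXn2r ?nnegrE ?(le_trans _ (hX i j)).
apply: le_trans (ler_sum _ (fun i _ => H i)) _.
by rewrite sumr_const card_ord -mulrnAl -mulrnA mulnC mulr_natr.
Qed.

Lemma entries_exists a b (X : 'M[R]_(a, b)) : exists2 c, 0 <= c & entries_le X c.
Proof.
exists (\sum_i \sum_j `|X i j|); first by do 2!apply: sumr_ge0 => ? _.
move=> i j; rewrite (bigD1 i) //= (bigD1 j) //= -addrA lerDl addr_ge0 //.
  exact: sumr_ge0.
by apply: sumr_ge0 => *; apply: sumr_ge0.
Qed.

Lemma entries_leM a b c (X : 'M[R]_(a, b)) (Y : 'M[R]_(b, c)) u v :
  entries_le X u -> entries_le Y v -> entries_le (X *m Y) (u * v *+ b).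
Proof.
move=> hX hY i j; rewrite mxE; apply: le_trans (ler_norm_sum _ _ _) _.
rewrite -[X in _ *+ X]card_ord -sumr_const; apply: ler_sum => l _.
by rewrite normrM ler_pM.
Qed.

Lemma entries_leD a b (X Y : 'M[R]_(a, b)) u v :
  entries_le X u -> entries_le Y v -> entries_le (X + Y) (u + v).
Proof. by move=> hX hY i j; rewrite mxE (le_trans (ler_normD _ _)) // lerD. Qed.

Lemma entries_leN a b (X : 'M[R]_(a, b)) u : entries_le X u -> entries_le (- X) u.
Proof. by move=> hX i j; rewrite mxE normrN. Qed.

Lemma entries_leZ a b (X : 'M[R]_(a, b)) c d u : `|c| <= d ->
  entries_le X u -> entries_le (c *: X) (d * u).
Proof. by move=> hc hX i j; rewrite mxE normrM ler_pM. Qed.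

Lemma entries_le_tr a b (X : 'M[R]_(a, b)) u : entries_le X u -> entries_le X^T u.
Proof. by move=> hX i j; rewrite mxE. Qed.

Lemma entries_le1 k : entries_le (1%:M : 'M[R]_k) 1.
Proof. by move=> i j; rewrite mxE; case: (i == j); rewrite ?normr1 ?normr0. Qed.

Lemma mx_bounded_on a b (F : R -> 'M[R]_(a, b)) T :
  (forall i j, cont_from 0 (fun s => F s i j)) -> 0 <= T ->
  exists2 c, 0 <= c & forall s, 0 <= s <= T -> entries_le (F s) c.
Proof.
move=> hF T0.
have /fin_all_exists[f hf] : forall ij : 'I_a * 'I_b,
    exists k, forall s, 0 <= s <= T -> `|F s ij.1 ij.2| <= k.
  by move=> ij; exact: cont_from_bounded.
exists (\sum_ij `|f ij|); first exact: sumr_ge0.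
move=> s hs i j; apply: le_trans (hf (i, j) s hs) _.
by rewrite (bigD1 (i, j)) //= (le_trans (ler_norm _)) // lerDl sumr_ge0.
Qed.

Lemma unit_of_inj k (X : 'M[R]_k) : (forall x : 'cV[R]_k, X *m x = 0 -> x = 0) -> X \in unitmx.
Proof.
move=> h; rewrite -unitmx_tr -row_free_unit -kermx_eq0; apply/eqP/row_matrixP => i.
rewrite row0; apply: trmx_inj; rewrite trmx0; apply: h.
by rewrite -[X in X *m _]trmxK -trmx_mul -row_mul mulmx_ker row0 trmx0.
Qed.

Definition coercive k (X : 'M[R]_k) (c : R) := forall x, c * dot x x <= dot x (X *m x).

Lemma coercive_unit k (X : 'M[R]_k) c : 0 < c -> coercive X c -> X \in unitmx.
Proof.
move=> c0 h; apply: unit_of_inj => x x0; apply: dot_eq0; apply/eqP.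
have := h x; rewrite x0 dot0r => h'.
by rewrite eq_le dot_ge0 andbT -(pmulr_rle0 _ c0).
Qed.

Lemma pdmx_form k (X : 'M[R]_k) : pdmx X -> psd_form X.
Proof.
case=> _ h x; have [->|x0] := eqVneq x 0; first by rewrite mulmx0 dot0r.
by rewrite -quadE ltW // h.
Qed.

(** Neither eigenvalues nor compactness of the sphere: Cauchy-Schwarz for the form [X], applied to
    [x] and [X^-1 x], gives [|x|^4 <= (x^T X x) (x^T X^-1 x)], and the last factor is at most a
    multiple of [|x|^2] because the entries of [X^-1] are bounded. *)
Lemma pdmx_coercive k (X : 'M[R]_k) : pdmx X -> exists2 c, 0 < c & coercive X c.
Proof.
move=> pX; have [sX hX] := pX.
have uX : X \in unitmx.
  apply: unit_of_inj => x x0; apply/eqP; apply/negPn/negP => /hX.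
  by rewrite quadE x0 dot0r ltxx.
have [b b0 hb] := entries_exists (invmx X).
set c := b * k%:R * 2 + 1.
have c0 : 0 < c by rewrite /c; have := ler0n R k; nra.
exists c^-1; first by rewrite invr_gt0.
move=> x; rewrite mulrC ler_pdivrMr //.
have CS := psd_CS x (invmx X *m x) sX (pdmx_form pX).
rewrite mulKVmx // in CS.
have h1 := form_bound x x b0 hb.
have h2 : dot (invmx X *m x) x <= c * dot x x.
  rewrite dotC; apply: le_trans (ler_norm _) (le_trans h1 _).
  by rewrite /c; have := dot_ge0 x; lra.
have [x0|x0] := eqVneq (dot x x) 0; first by rewrite x0 mulr_ge0 ?(pdmx_form pX) // ltW.
have x0' : 0 < dot x x by rewrite lt_def x0 dot_ge0.
rewrite -(ler_pM2r x0') -expr2; apply: le_trans CS _.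
rewrite -mulrA; apply: ler_wpM2l; [exact: pdmx_form|exact: h2].
Qed.

End QuadraticForms.

(** * The Riccati equation *)

(** If [P] failed at [t1], the supremum of the times up to which [P] holds would itself satisfy [P]
    by left closure and could then be exceeded. The length [e] of a step may depend on [t], so no
    uniform step size has to be found. *)
Lemma real_induction (R : realType) (P : R -> Prop) : P 0 ->
  (forall t, 0 <= t -> P t ->
     exists2 e, 0 < e & forall s, t <= s <= t + e -> P s) ->
  (forall t, 0 < t -> (forall s, 0 <= s < t -> P s) -> P t) ->
  forall t, 0 <= t -> P t.
Proof.
move=> P0 Pr Pl t1 t10; apply: contrapT => nP.
pose B := [set t | 0 <= t /\ forall s, 0 <= s <= t -> P s].
have B0 : B 0.
  by split=> // s; rewrite -eq_le => /eqP <-.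
have ubB : ubound B t1.
  move=> t [t0 ht]; rewrite leNgt; apply/negP => t1t; apply: nP; apply: ht.
  by rewrite t10 ltW.
have hB : has_sup B by split; [exists 0|exists t1].
set tau := sup B.
have tau0 : 0 <= tau by exact: sup_upper_bound.
have below s : 0 <= s < tau -> P s.
  move=> /andP[s0 st].
  have ts0 : 0 < tau - s by rewrite subr_gt0.
  have [b [b0 hb] sb] := sup_adherent ts0 hB.
  by apply: hb; rewrite s0 ltW //; move: sb; rewrite -/tau subKr.
have Ptau : P tau.
  move: tau0; rewrite le_eqVlt => /predU1P[<- //|tau0]; exact: Pl.
have [e e0 he] := Pr _ tau0 Ptau.
have : B (tau + e).
  split; first by lra.
  move=> s /andP[s0 se]; have [st|ts] := ltP s tau; first by apply: below; rewrite s0.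
  by apply: he; rewrite ts.
move=> /(sup_upper_bound hB); rewrite -/tau; lra.
Qed.

(** The quadratic term [X D X] is shared equally between [F X] and [X F^T], which turns the Riccati
    right-hand side into a Lyapunov one. What remains is the forcing term, close to [S] for small
    [c]. *)
Lemma riccati_shift (R : realType) k (A S D X : 'M[R]_k) (c : R) :
  X^T = X -> D^T = D ->
  let F := A - c *: D - (1 / 2) *: (X *m D) in
  A *m (X + c%:M) + (X + c%:M) *m A^T - (X + c%:M) *m D *m (X + c%:M) + S =
  F *m X + X *m F^T + (S + c *: (A + A^T) - c ^+ 2 *: D).
Proof.
move=> sX sD F; rewrite /F !(mxtrD, mxtrN, mxtrZ) !trmx_mul sX sD.
rewrite !(mulmxDl, mulmxDr, mulNmx, mulmxN) -!scalemxAl -!scalemxAr.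
rewrite !(mul_scalar_mx, mul_mx_scalar) -!scalemxAl ?mulmxA.
by apply/matrixP => i j; rewrite ?(mxDE, mxNE, mxZE); field.
Qed.

(** [X1 = (1 + h F) X (1 + h F)^T + h (Y - E) - h^2 F X F^T]: the first term is a congruence of [X],
    and half of the coercivity of [Y] absorbs [E], the other half the term of order [h^2]. *)
Lemma psd_step (R : realType) k (X X1 F Y E : 'M[R]_k) (h r C : R) :
  X^T = X -> psd_form X -> 0 <= h ->
  X1 = X + h *: (F *m X + X *m F^T + Y - E) ->
  (forall x, dot x (F *m X *m F^T *m x) <= C * dot x x) ->
  coercive Y r -> (forall x, dot x (E *m x) <= r / 2 * dot x x) ->
  h * C <= r / 2 -> psd_form X1.
Proof.
move=> sX pX h0 -> hC hY hE hCr x; pose v := F^T *m x.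
have hv : dot v (X *m v) <= C * dot x x.
  by rewrite (_ : dot v _ = dot x (F *m X *m F^T *m x)) // /v -!mulmxA [RHS]dot_mul.
have := pX (x + h *: v).
rewrite mulmxDr -scalemxAr !dotDr !dotDl !dotZr !dotZl.
have -> : dot x (X *m v) = dot v (X *m x) by rewrite dot_mul sX dotC.
rewrite mulmxDl -scalemxAl !mulmxDl mulNmx !(dotDr, dotZr, dotNr).
have -> : dot x (F *m X *m x) = dot v (X *m x) by rewrite -mulmxA dot_mul.
have -> : dot x (X *m F^T *m x) = dot v (X *m x).
  by rewrite -mulmxA dot_mul sX dotC.
have := hY x; have := hE x; have := dot_ge0 x.
set q := dot x x in hv *; set b := dot v (X *m x); set c := dot v (X *m v) in hv *.
set a := dot x (X *m x); set y := dot x (Y *m x); set e := dot x (E *m x) => q0 he hy.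
have e1 : h * (r * q) <= h * y by rewrite ler_wpM2l.
have e2 : h * e <= h * (r / 2 * q) by rewrite ler_wpM2l.
have e3 : h * (h * c) <= h * (h * (C * q)) by rewrite !ler_wpM2l.
have e4 : h * C * (h * q) <= r / 2 * (h * q) by rewrite ler_wpM2r // mulr_ge0.
nra.
Qed.

(** * Duality between the Riccati equation and the controlled adjoint system *)

Section Duality.
Context {R : realType} (k : nat).
Implicit Types A D M S X G : 'M[R]_k.

Lemma rderiv_form (t0 : R) (X : R -> 'M[R]_k) (x y : R -> 'cV[R]_k) t X' x' y' :
  deriv_from t0 X t X' -> deriv_from t0 x t x' -> deriv_from t0 y t y' ->
  rderiv t0 (fun s => dot (x s) (X s *m y s)) t
    (dot x' (X t *m y t) + dot (x t) (X' *m y t) + dot (x t) (X t *m y')).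
Proof.
move=> hX hx hy.
have := (deriv_fromP _ _ _ _).1 (deriv_fromM (deriv_from_tr hx) (deriv_fromM hX hy)) 0 0.
by rewrite mulmxDr !mxDE addrA.
Qed.

(* Completion of the square in the control [D z] of the adjoint equation. *)
Lemma riccati_dual A D M S (y z : 'cV[R]_k) : M^T = M -> D^T = D -> psd_form D ->
  let y' := D *m z - A^T *m y in
  dot y' (M *m y) + dot y ((A *m M + M *m A^T - M *m D *m M + S) *m y)
    + dot y (M *m y') <= dot y (S *m y) + dot z (D *m z).
Proof.
move=> sM sD pD; cbv zeta.
have := pD (M *m y - z); set w := M *m y.
rewrite mulmxBr dotBr !dotBl.
rewrite (_ : dot z (D *m w) = dot w (D *m z)); last by rewrite dot_mul sD dotC.
rewrite !(mulmxDl, mulNmx) !(dotDr, dotNr) -!mulmxA -/w.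
rewrite (_ : dot y (A *m w) = dot w (A^T *m y)); last by rewrite dot_mul dotC.
rewrite (_ : dot y (M *m (A^T *m y)) = dot w (A^T *m y)); last by rewrite dot_mul sM.
rewrite (_ : dot y (M *m (D *m w)) = dot w (D *m w)); last by rewrite dot_mul sM.
rewrite (_ : dot y (M *m (D *m z - _)) = dot w (D *m z) - dot w (A^T *m y)); last first.
  by rewrite dot_mul sM dotBr.
rewrite ?dotBl [dot (A^T *m y) w]dotC [dot (D *m z) w]dotC.
lra.
Qed.

(** As [A^2 = 0], the exponentials of [h A] and [- h A^T] are [1 + h A] and [1 - h A^T]; the second
    is the inverse of the transpose of the first. *)
Lemma flow_adjoint A (h : R) : A *m A = 0 ->
  (1%:M + h *: - A^T) *m (1%:M + h *: A)^T = 1%:M.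
Proof.
move=> A2; have A2T : A^T *m A^T = 0 by rewrite -trmx_mul A2 trmx0.
rewrite mxtrD mxtrZ trmx1 mulmxDl mul1mx mulmxDr mulmx1 -scalemxAl mulNmx -scalemxAr A2T.
by rewrite !(scaler0, oppr0, addr0, scalerN) addrK.
Qed.

(** The left side is the derivative of [y = F G c] when [G] has derivative [E^T D E]. The identity
    says that this explicit [y] solves [y' = D z - A^T y] with the control [z = E c]. *)
Lemma flow_dual A D G (c : 'cV[R]_k) (h : R) : A *m A = 0 ->
  let E := 1%:M + h *: A in
  let F := 1%:M + h *: - A^T in
  (- A^T *m G + F *m (E^T *m D *m E)) *m c = D *m (E *m c) - A^T *m (F *m G *m c).
Proof.
move=> A2 E F; have A2T : A^T *m A^T = 0 by rewrite -trmx_mul A2 trmx0.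
have -> : F *m (E^T *m D *m E) = D *m E by rewrite !mulmxA flow_adjoint // mul1mx.
have AF : A^T *m F = A^T.
  by rewrite /F mulmxDr mulmx1 -scalemxAr mulmxN A2T oppr0 scaler0 addr0.
rewrite mulmxDl addrC !mulNmx -mulmxA; congr (_ - _).
by rewrite -[in RHS]mulmxA [RHS]mulmxA AF mulmxA.
Qed.

End Duality.

Lemma flow_entries (R : realType) k (A : 'M[R]_k) (a h T : R) : 0 <= a -> entries_le A a ->
  0 <= h <= T -> entries_le (1%:M + h *: A) (1 + T * a).
Proof.
move=> a0 hA /andP[h0 hT]; apply: entries_leD; first exact: entries_le1.
by apply: entries_leZ => //; rewrite ger0_norm.
Qed.

(** * Bounds and derivative for the inverse of a matrix function *)

Section Inverse.
Context {R : realType} (k : nat).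

(** A column [x] of the inverse solves [X x = e_j], so [c |x|^2 <= x . e_j <= |x|], hence
    [|x| <= 1 / c]. *)
Lemma coercive_invmx_entries (X : 'M[R]_k) (c : R) : 0 < c -> coercive X c ->
  entries_le (invmx X) c^-1.
Proof.
move=> c0 hX i j; pose x := col j (invmx X).
have uX := coercive_unit c0 hX.
have Xx : X *m x = col j 1%:M by rewrite /x !colE mulmxA mulmxV.
have h1 := hX x; rewrite Xx in h1.
have jj : dot (col j (1%:M : 'M[R]_k)) (col j 1%:M) = 1.
  rewrite dotE (bigD1 j) //= !mxE eqxx mulr1 big1 ?addr0 // => l lj.
  by rewrite !mxE (negbTE lj) mul0r.
have h2 := dot_CS x (col j 1%:M); rewrite jj mulr1 in h2.
have h3 : (c * dot x x) ^+ 2 <= dot x x.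
  apply: le_trans h2; rewrite lerXn2r ?nnegrE ?(le_trans _ h1) // mulr_ge0 ?dot_ge0 //;
  exact: ltW.
have xx : dot x x <= c^-1 ^+ 2.
  have [x0|x0] := eqVneq (dot x x) 0; first by rewrite x0 sqr_ge0.
  have x1 : 0 < dot x x by rewrite lt_def x0 dot_ge0.
  have : c ^+ 2 * dot x x <= 1.
    by rewrite -(ler_pM2l x1) mulr1; apply: le_trans h3; rewrite le_eqVlt; apply/orP; left; apply/eqP; ring.
  by rewrite exprVn -ler_pdivlMl ?exprn_gt0 // mulr1.
have : `|invmx X i j| ^+ 2 <= c^-1 ^+ 2.
  apply: le_trans xx; rewrite real_normK ?num_real // dotE (bigD1 i) //= [col _ _ _ _]mxE -expr2.
  by rewrite lerDl sumr_ge0 // => l _; rewrite -expr2 sqr_ge0.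
by rewrite ler_pXn2r ?nnegrE // invr_ge0 ltW.
Qed.

(** Everything follows from [W(s) - W(t) = - W(s) (M(s) - M(t)) W(t)] for [W = M^-1]: the bound [w]
    first yields continuity of [W], and then the difference quotients converge. *)
Lemma deriv_from_invmx (t0 t w : R) (M : R -> 'M[R]_k) M' : t0 <= t ->
  (forall s, t0 <= s -> M s \in unitmx) ->
  (forall s, t0 <= s -> entries_le (invmx (M s)) w) ->
  deriv_from t0 M t M' ->
  deriv_from t0 (fun s => invmx (M s)) t (- (invmx (M t) *m M' *m invmx (M t))).
Proof.
move=> t0t uM bW dM.
have diff s : t0 <= s -> invmx (M s) - invmx (M t) =
    - (invmx (M s) *m (M s - M t) *m invmx (M t)).
  move=> ts; rewrite mulmxBr mulVmx ?uM // mulmxBl mul1mx -mulmxA mulmxV ?uM //.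
  by rewrite mulmx1 opprB.
have cW : invmx (M s) @[s --> within `[t0, +oo[ t^'] --> invmx (M t).
  apply/cvg_mxP => i j; apply/cvgrPdist_le => e e0.
  pose K := (w * 1 *+ k) * w *+ k.
  have w0 : 0 <= w by exact: le_trans (normr_ge0 _) (bW t t0t i j).
  have K0 : 0 <= K by rewrite /K mulrn_wge0 // mulr_ge0 // mulrn_wge0 // mulr1.
  pose eta := e / (K + 1).
  have K1 : 0 < K + 1 by rewrite ltr_wpDl.
  have eta0 : 0 < eta by rewrite divr_gt0.
  have /cvg_ballP /(_ eta eta0) := deriv_from_cvg dM.
  rewrite !near_withinE; apply: filterS => s hs sn ss.
  have ts : t0 <= s by move: ss; rewrite /= in_itv /= andbT.
  have bM : entries_le (M s - M t) eta.
    move=> i' j'; have [_ /(_ i' j')] := hs sn ss; rewrite /ball /= distrC mxDE mxNE.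
    exact: ltW.
  rewrite distrC -mxNE -mxDE diff // mxNE normrN.
  apply: le_trans (entries_leM (entries_leM (bW s ts) bM) (bW t t0t) i j) _.
  have -> : (w * eta *+ k) * w *+ k = K * eta by rewrite /K; ring.
  rewrite /eta mulrCA -[leRHS]mulr1 ler_wpM2l ?ltW //.
  by rewrite ltr_pdivrMr // mul1r ltrDl.
have H : invmx (M s) *m ((s - t)^-1 *: (M s - M t)) *m - invmx (M t)
    @[s --> within `[t0, +oo[ t^'] --> - (invmx (M t) *m M' *m invmx (M t)).
  rewrite -mulmxN; apply: cvg_mulmx; last exact: cvg_cst.
  exact: cvg_mulmx.
rewrite /deriv_from cvg_mxP => i j; rewrite cvg_mxP in H; have Hij := H i j.
apply: near_cvg Hij; rewrite near_withinE; apply: nearW => s ss.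
have ts : t0 <= s by move: ss; rewrite /= in_itv /= andbT.
by rewrite diff // mulmxN -scalemxAr -scalemxAl scalerN.
Qed.

End Inverse.

(** The terms in [A] cancel and the left side equals [(1 - 2 kappa) x^T D x - z^T S z] with
    [z = W x]; this is where [kappa >= 1/2] enters. *)
Lemma lyapunov_decrease (R : realType) k (A D M S W : 'M[R]_k) (kappa : R) (x : 'cV[R]_k) :
  M^T = M -> W^T = W -> M *m W = 1%:M -> W *m M = 1%:M ->
  psd_form D -> 1 / 2 <= kappa ->
  let x' := (A - kappa *: (M *m D)) *m x in
  dot x' (W *m x)
    + dot x (- (W *m (A *m M + M *m A^T - M *m D *m M + S) *m W) *m x)
    + dot x (W *m x') <= - dot (W *m x) (S *m (W *m x)).
Proof.
move=> sM sW MW WM pD hk; cbv zeta; set z := W *m x.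
have xz : x = M *m z by rewrite /z mulmxA MW mul1mx.
have -> : dot x (W *m ((A - kappa *: (M *m D)) *m x)) = dot z ((A - kappa *: (M *m D)) *m x).
  by rewrite dot_mul sW.
rewrite [dot _ z]dotC mulNmx dotNr -!mulmxA -/z [dot x _]dot_mul sW -/z.
rewrite !(mulmxDl, mulNmx) -scalemxAl !(dotDr, dotNr, dotZr) -!mulmxA -xz.
have -> : dot z (M *m (A^T *m z)) = dot z (A *m x).
  by rewrite dot_mul sM -xz dot_mul trmxK dotC.
have -> : dot z (M *m (D *m x)) = dot x (D *m x) by rewrite dot_mul sM -xz.
have := pD x; set p := dot x (D *m x); set q := dot z (A *m x); set r := dot z (S *m z) => p0.
have : 0 <= (kappa - 1 / 2) * p by rewrite mulr_ge0 // subr_ge0.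
lra.
Qed.

(** * Symmetry and uniform bounds of the Riccati solution, and decay of the error *)

Section Riccati.
Context {R : realType} (k : nat).
Variables (A S : 'M[R]_k) (D M : R -> 'M[R]_k) (bD s0 : R).
Hypothesis sD : forall t, 0 <= t -> (D t)^T = D t.
Hypothesis pD : forall t, 0 <= t -> psd_form (D t).
Hypothesis bD0 : 0 <= bD.
Hypothesis hbD : forall t, 0 <= t -> entries_le (D t) bD.
Hypothesis sS : S^T = S.
Hypothesis s00 : 0 < s0.
Hypothesis cS : coercive S s0.
Hypothesis M0 : M 0 = 1%:M.
Hypothesis dM : forall t, 0 <= t ->
  deriv_from 0 M t (A *m M t + M t *m A^T - M t *m D t *m M t + S).

Lemma riccati_bounded_on T : 0 <= T ->
  exists2 c, 0 <= c & forall s, 0 <= s <= T -> entries_le (M s) c.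
Proof. by move=> T0; apply: mx_bounded_on => // i j; exact: deriv_from_cont dM. Qed.

(* [X = M - M^T] solves the linear equation [X' = G X + X G^T], [G = A - M D]. *)
Lemma riccati_sym t : 0 <= t -> (M t)^T = M t.
Proof.
move=> t0; have [m m0 hm] := riccati_bounded_on t0.
have [a a0 ha] := entries_exists A.
pose X s := M s - (M s)^T; pose G s := A - M s *m D s.
pose g := a + m * bD *+ k.
have hG s : 0 <= s <= t -> entries_le (G s) g.
  move=> /andP[s0' st]; apply: entries_leD => //; apply: entries_leN.
  by apply: entries_leM; [apply: hm; rewrite s0'|exact: hbD].
have dX s : 0 <= s -> deriv_from 0 X s (G s *m X s + X s *m (G s)^T).
  move=> hs; have := deriv_fromB (dM hs) (deriv_from_tr (dM hs)).
  rewrite /G /X; congr deriv_from.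
  rewrite !(mxtrD, mxtrN) !trmx_mul trmxK sD // sS.
  rewrite !(mulmxBl, mulmxBr) !mulmxA.
  mxmodule.
(* The squared Frobenius norm of [X] vanishes at 0 and satisfies a linear differential inequality on
   [[0, t]], so it stays zero. *)
pose phi s := \sum_i \sum_j X s i j ^+ 2.
pose X' s := G s *m X s + X s *m (G s)^T.
have dphi s : 0 <= s <= t -> rderiv 0 phi s (\sum_i \sum_j (X' s i j * X s i j + X s i j * X' s i j)).
  move=> /andP[hs _]; apply: rderiv_sum => i; apply: rderiv_sum => j.
  have Xij := (deriv_fromP _ _ _ _).1 (dX _ hs) i j.
  exact: (rderivM Xij Xij).
have phi_le s : 0 <= s <= t ->
    \sum_i \sum_j (X' s i j * X s i j + X s i j * X' s i j) <= (4 * k%:R * g) * phi s.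
  move=> hs.
  (* The bound is spread over a triple sum so that it can be compared term by term with the expanded
     matrix products. *)
  have -> : (4 * k%:R * g) * phi s =
      \sum_(i < k) \sum_(j < k) \sum_(l < k) g * (2 * X s i j ^+ 2 + X s l j ^+ 2 + X s i l ^+ 2).
    under eq_bigr do under eq_bigr do rewrite -mulr_sumr !big_split /= sumr_const card_ord.
    under eq_bigr do rewrite -mulr_sumr !big_split /=.
    rewrite -mulr_sumr !big_split /=.
    have -> : \sum_(i < k) \sum_(j < k) \sum_(l < k) X s l j ^+ 2 = phi s *+ k.
      by rewrite sumr_const card_ord /phi exchange_big.
    have -> : \sum_(i < k) \sum_(j < k) \sum_(l < k) X s i l ^+ 2 = phi s *+ k.
      by under eq_bigr do rewrite sumr_const card_ord; rewrite sumrMnl.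
    have -> : \sum_(i < k) \sum_(j < k) (2 * X s i j ^+ 2) *+ k = 2 * phi s *+ k.
      under eq_bigr do rewrite sumrMnl -mulr_sumr.
      by rewrite sumrMnl -mulr_sumr.
    ring.
  apply: ler_sum => i _; apply: ler_sum => j _.
  have -> : X' s i j * X s i j + X s i j * X' s i j = \sum_l 2 * X s i j * (G s i l * X s l j + X s i l * G s j l).
    rewrite -mulr_sumr big_split /=.
    have -> : \sum_l X s i l * G s j l = (X s *m (G s)^T) i j.
      by rewrite mxME; apply: eq_bigr => l _; rewrite mxTE.
    by rewrite -mxME -mxDE -/(X' s); ring.
  apply: ler_sum => l _.
  have := hG s hs i l; have := hG s hs j l.
  rewrite !ler_norml => /andP[+ +] /andP[+ +].
  set x := X s i j; set y := X s l j; set z := X s i l; set p := G s i l; set q := G s j l.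
  move=> h1 h2 h3 h4.
  (* Together the four squares give [2 p x y <= g (x^2 + y^2)] and [2 q x z <= g (x^2 + z^2)]. *)
  have a1 : 0 <= (g + p) * (x - y) ^+ 2 by rewrite mulr_ge0 ?sqr_ge0; lra.
  have a2 : 0 <= (g - p) * (x + y) ^+ 2 by rewrite mulr_ge0 ?sqr_ge0; lra.
  have a3 : 0 <= (g + q) * (x - z) ^+ 2 by rewrite mulr_ge0 ?sqr_ge0; lra.
  have a4 : 0 <= (g - q) * (x + z) ^+ 2 by rewrite mulr_ge0 ?sqr_ge0; lra.
  nra.
have := rderiv_gronwall (lexx 0) t0 dphi phi_le.
have -> : phi 0 = 0.
  by rewrite /phi big1 // => i _; rewrite big1 // => j _; rewrite /X M0 trmx1 subrr mxE expr0n.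
rewrite mul0r => phi0.
have X0 i j : X t i j = 0.
  apply/eqP; rewrite -sqrf_eq0 eq_le sqr_ge0 andbT; apply: le_trans phi0.
  rewrite /phi (bigD1 i) //= (bigD1 j) //= -addrA lerDl addr_ge0 //.
    by apply: sumr_ge0 => *; rewrite sqr_ge0.
  by apply: sumr_ge0 => *; apply: sumr_ge0 => *; rewrite sqr_ge0.
by apply/matrixP => i j; have := X0 i j; rewrite !mxE => /eqP; rewrite subr_eq0 => /eqP ->.
Qed.

Lemma riccati_lower : exists2 l0, 0 < l0 & forall t, 0 <= t -> coercive (M t) l0.
Proof.
have [a a0 ha] := entries_exists A.
pose alpha := a * k%:R * 2; pose beta := bD * k%:R * 2.
have fA x : `|dot x (A *m x)| <= alpha * dot x x.
  by apply: le_trans (form_bound x x a0 ha) _; rewrite /alpha le_eqVlt; apply/orP; left; apply/eqP; ring.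
have fD t x : 0 <= t -> dot x (D t *m x) <= beta * dot x x.
  move=> t0; apply: le_trans (ler_norm _) _; apply: le_trans (form_bound x x bD0 (hbD t0)) _.
  by rewrite /beta le_eqVlt; apply/orP; left; apply/eqP; ring.
pose w := 2 * alpha + beta + 1.
have alpha0 : 0 <= alpha by rewrite /alpha !mulr_ge0.
have beta0 : 0 <= beta by rewrite /beta !mulr_ge0.
have w0 : 0 < w by rewrite /w; lra.
(* The cap 1 makes [M 0 - l0] nonnegative and gives [l0^2 <= l0]; the other bound leaves the forcing
   term [Rm] coercive with constant [s0 / 2]. *)
pose l0 := Num.min 1 (s0 / (2 * w)).
have l00 : 0 < l0 by rewrite /l0 lt_min ltr01 divr_gt0 // mulr_gt0.
have l01 : l0 <= 1 by rewrite /l0 ge_min lexx.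
have l0w : l0 * w <= s0 / 2.
  have : l0 <= s0 / (2 * w) by rewrite /l0 ge_min lexx orbT.
  rewrite ler_pdivlMr ?mulr_gt0 //; lra.
pose Rm t := S + l0 *: (A + A^T) - l0 ^+ 2 *: D t.
have hR t x : 0 <= t -> s0 / 2 * dot x x <= dot x (Rm t *m x).
  move=> t0; rewrite /Rm mulmxBl mulmxDl -!scalemxAl mulmxDl dotBr dotDr !dotZr dotDr.
  rewrite dot_mulT [dot (A *m x) x]dotC.
  have := cS x; have := fA x; have := fD _ x t0; have := dot_ge0 x.
  rewrite ler_norml; set q := dot x x; set y := dot x (A *m x); set z := dot x (D t *m x).
  move=> q0 h1 /andP[h2 h3] h4.
  have e1 : l0 * (- (alpha * q)) <= l0 * y by apply: ler_wpM2l => //; exact: ltW.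
  have e2 : l0 ^+ 2 * z <= l0 ^+ 2 * (beta * q) by apply: ler_wpM2l => //; exact: sqr_ge0.
  have e3 : l0 ^+ 2 * (beta * q) <= l0 * (beta * q).
    apply: ler_wpM2r; first exact: mulr_ge0.
    by rewrite expr2 -[leRHS]mulr1 ler_wpM2l // ltW.
  have e4 : l0 * w * q <= s0 / 2 * q by apply: ler_wpM2r.
  have e5 : 0 <= l0 * q by rewrite mulr_ge0 // ltW.
  have e6 : l0 * w * q = 2 * (l0 * (alpha * q)) + l0 * (beta * q) + l0 * q.
    by rewrite /w; ring.
  lra.
pose X t := M t - l0%:M.
have formX t x : dot x (X t *m x) = dot x (M t *m x) - l0 * dot x x.
  by rewrite /X mulmxBl dotBr mul_scalar_mx dotZr.
suff main t : 0 <= t -> psd_form (X t).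
  by exists l0 => // t t0 x; have := main t t0 x; rewrite formX subr_ge0.
apply: (real_induction (P := fun t => psd_form (X t))) => {t}.
- by move=> x; rewrite formX M0 mul1mx -[X in X - _]mul1r -mulrBl mulr_ge0 ?dot_ge0 // subr_ge0.
- move=> t t0 pX.
  pose F := A - l0 *: D t - (1 / 2) *: (X t *m D t).
  have MX : M t = X t + l0%:M by rewrite /X subrK.
  have sX : (X t)^T = X t by rewrite /X linearB /= riccati_sym // tr_scalar_mx.
  pose M' := F *m X t + X t *m F^T + Rm t.
  have dMt : deriv_from 0 M t M'.
    have := dM t0; congr deriv_from; rewrite /M' /F /Rm MX.
    exact: (riccati_shift A S l0 sX (sD t0)).
  have [c c0 hc] := entries_exists (F *m X t *m F^T).
  pose C := c * k%:R * 2 + 1.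
  have C0 : 0 < C by rewrite ltr_wpDl // !mulr_ge0.
  have hFX y : dot y (F *m X t *m F^T *m y) <= C * dot y y.
    apply: le_trans (ler_norm _) (le_trans (form_bound y y c0 hc) _).
    by rewrite /C; have := dot_ge0 y; lra.
  (* By [form_bound], entries below [eta] give a form below [s0 / 4], half of the coercivity of
     [Rm]; the [+ 1] covers [k = 0]. *)
  pose eta := s0 / (8 * (k%:R + 1)).
  have k1 : 0 < k%:R + 1 :> R by rewrite ltr_wpDl.
  have eta0 : 0 < eta by rewrite divr_gt0 // mulr_gt0.
  have [d d0 hd] : exists2 d, 0 < d & forall s, t < s < t + d ->
      entries_le (M' - (s - t)^-1 *: (M s - M t)) eta.
    move/cvg_ballP : dMt => /(_ eta eta0); rewrite near_withinE.
    move=> /nbhs_ballP[d /= d0 hd]; exists d => // s /andP[ts std] i j.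
    have [] := hd s; rewrite ?in_itv /= ?andbT.
    - by rewrite /ball /= ltr_norml; apply/andP; split; lra.
    - by rewrite gt_eqF.
    - by lra.
    move=> _ /(_ i j); rewrite /ball /= => /ltW; apply: le_trans.
    by rewrite !mxE.
  (* The first bound keeps [s] strictly inside the interval where the difference quotient is
     accurate; the second is the smallness of [h] asked by [psd_step] with [r = s0 / 2]. *)
  exists (Num.min (d / 2) (s0 / (4 * C))).
    by rewrite lt_min !divr_gt0 // mulr_gt0.
  move=> s /andP[]; rewrite le_eqVlt => /predU1P[<- //|ts].
  rewrite -lerBlDl le_min => /andP[sd sC] x.
  set h := s - t in sd sC.
  have h0 : 0 < h by rewrite subr_gt0.
  pose Eps := M' - h^-1 *: (M s - M t).
  have hE : entries_le Eps eta.
    by apply: hd; rewrite ts /=; move: sd; rewrite /h; lra.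
  have Xs : X s = X t + h *: (M' - Eps).
    rewrite /Eps subKr scalerA divff ?lt0r_neq0 // scale1r /X.
    by mxmodule.
  have hEx' y : dot y (Eps *m y) <= s0 / 2 / 2 * dot y y.
    apply: le_trans (ler_norm _) (le_trans (form_bound y y (ltW eta0) hE) _).
    rewrite /eta.
    have -> : s0 / (8 * (k%:R + 1)) * k%:R * (dot y y + dot y y) =
              (s0 / 2 / 2 * dot y y) * (k%:R / (k%:R + 1)).
      by field; rewrite lt0r_neq0.
    rewrite -[leRHS]mulr1 ler_wpM2l //.
      by rewrite mulr_ge0 ?dot_ge0 // !divr_ge0 // ltW.
    by rewrite ler_pdivrMr // mul1r lerDl.
  apply: (psd_step sX pX (ltW h0) Xs _ (hR t ^~ t0) hEx' _ x) => [y|].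
    exact: hFX.
  rewrite (_ : s0 / 2 / 2 = s0 / 4); last by field.
  by move: sC; rewrite !ler_pdivlMr ?mulr_gt0 //; lra.
(* Left closure: a negative value of the form at [t] would persist at slightly earlier times, by
   continuity of [M]. *)
- move=> t t0 pX x; rewrite leNgt; apply/negP => neg.
  have : rderiv 0 (fun s => (x^T *m (X s *m x)) 0 0) t
     ((x^T *m (((A *m M t + M t *m A^T - M t *m D t *m M t + S) - 0) *m x)) 0 0).
    apply: (deriv_fromP _ _ _ _).1; apply: deriv_fromMl; apply: deriv_fromMr.
    by apply: deriv_fromB; [exact: dM (ltW t0)|exact: deriv_from_cst].
  move=> /rderiv_near /cvgrPdist_lt.
  have neg' : 0 < - dot x (X t *m x) by rewrite oppr_gt0.
  move=> /(_ _ neg'); rewrite near_withinE => /nbhs_ballP[d /= d0 hd].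
  pose s := Num.max 0 (t - d / 2).
  have ss : 0 <= s < t by rewrite /s le_max lexx /= gt_max t0 /=; lra.
  have sd : t - d / 2 <= s by rewrite /s le_max lexx orbT.
  have := hd s; rewrite /ball /= in_itv /= andbT.
  move=> /(_ _ _); have := pX s ss x; rewrite -/(dot x (X s *m x)) -/(dot x (X t *m x)).
  move=> h1 h2; have {h2} : `|dot x (X t *m x) - dot x (X s *m x)| < - dot x (X t *m x).
    apply: h2; last by case/andP: ss.
    by rewrite ltr_norml; apply/andP; split; lra.
  by rewrite ltr_norml => /andP[]; lra.
Qed.

(** For [t >= T] the dual estimate is integrated over the window [[t - T, t]], along the control
    that steers the adjoint state from 0 to [y]. Earlier times form a compact interval, on which
    continuity suffices. *)
Lemma riccati_upper (T g : R) : A *m A = 0 -> 0 < T -> 0 < g ->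
  (forall t0, 0 <= t0 -> exists G : R -> 'M[R]_k,
    [/\ G t0 = 0,
        forall s, t0 <= s -> deriv_from 0 G s
          ((1%:M + (s - t0) *: A)^T *m D s *m (1%:M + (s - t0) *: A))
      & coercive (G (t0 + T)) g]) ->
  exists2 m, 0 < m &
    forall t, 0 <= t -> forall y, dot y (M t *m y) <= m * dot y y.
Proof.
move=> A2 T0 g0 obs.
have [a a0 ha] := entries_exists A.
have haT : entries_le (- A^T) a by apply: entries_leN; exact: entries_le_tr.
have [cS' cS0 hS] := entries_exists S.
(* On a window of length [T], [e] bounds the entries of both flows and [d] those of the derivative
   of the Gramian; [y2] and [z2] bound [|y|^2] and [|z|^2] relative to [|c|^2], and [K] bounds the
   running cost. *)
pose e := 1 + T * a; pose d := e * bD *+ k * e *+ k.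
pose y2 := (e * (d * T) *+ k) ^+ 2 * (k * k)%:R.
pose z2 := e ^+ 2 * (k * k)%:R.
pose K := cS' * k%:R * (2 * y2) + bD * k%:R * (2 * z2).
have e0 : 0 <= e by rewrite /e addr_ge0 // mulr_ge0 // ltW.
have d0 : 0 <= d by rewrite /d mulrn_wge0 // mulr_ge0 // mulrn_wge0 // mulr_ge0.
have y20 : 0 <= y2 by rewrite /y2 mulr_ge0 ?sqr_ge0.
have z20 : 0 <= z2 by rewrite /z2 mulr_ge0 ?sqr_ge0.
have K0 : 0 <= K by rewrite /K addr_ge0 // mulr_ge0 // mulr_ge0.
have ctrl t0 (c : 'cV[R]_k) (G : R -> 'M[R]_k) : 0 <= t0 -> G t0 = 0 ->
    (forall s, t0 <= s -> deriv_from 0 G s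
          ((1%:M + (s - t0) *: A)^T *m D s *m (1%:M + (s - t0) *: A))) ->
    let y := (1%:M + T *: - A^T) *m G (t0 + T) *m c in
    dot y (M (t0 + T) *m y) <= K * T * dot c c.
  move=> t00 G0 dG.
  have Ebd s : t0 <= s <= t0 + T -> entries_le (1%:M + (s - t0) *: A) e.
    by move=> hs; apply: flow_entries => //; lra.
  have Fbd s : t0 <= s <= t0 + T -> entries_le (1%:M + (s - t0) *: - A^T) e.
    by move=> hs; apply: flow_entries => //; lra.
  have dGbd s : t0 <= s <= t0 + T ->
      entries_le ((1%:M + (s - t0) *: A)^T *m D s *m (1%:M + (s - t0) *: A)) d.
    move=> hs; have s0' : 0 <= s by lra.
    apply: entries_leM (Ebd s hs); apply: entries_leM (hbD s0').
    exact: entries_le_tr (Ebd s hs).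
  have Gbd s : t0 <= s <= t0 + T -> entries_le (G s) (d * T).
    move=> /andP[hs hsT] i j.
    have der x : t0 <= x <= s -> rderiv 0 (fun s => G s i j) x
        (((1%:M + (x - t0) *: A)^T *m D x *m (1%:M + (x - t0) *: A)) i j).
      by move=> /andP[hx _]; have := (deriv_fromP _ _ _ _).1 (dG x hx) i j.
    have bd x : t0 <= x <= s ->
        - d <= ((1%:M + (x - t0) *: A)^T *m D x *m (1%:M + (x - t0) *: A)) i j <= d.
      move=> /andP[hx hxs]; have := dGbd x; rewrite hx (le_trans hxs) // => /(_ isT i j).
      by rewrite ler_norml.
    have h1 := rderiv_growth t00 hs der (fun x hx => (andP (bd x hx)).2).
    have h2 := rderiv_growth_ge t00 hs der (fun x hx => (andP (bd x hx)).1).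
    rewrite G0 mxE subr0 in h1 h2.
    have h3 : d * (s - t0) <= d * T by rewrite ler_wpM2l //; lra.
    by rewrite ler_norml; apply/andP; split; lra.
  pose y s := (1%:M + (s - t0) *: - A^T) *m G s *m c.
  pose z s := (1%:M + (s - t0) *: A) *m c.
  have dy s : t0 <= s -> deriv_from 0 y s (D s *m z s - A^T *m y s).
    move=> hs; rewrite /y /z -flow_dual //; apply: deriv_fromMr.
    apply: deriv_fromM; [exact: deriv_from_affine|exact: dG].
  pose f s := dot (y s) (M s *m y s).
  pose f' s := dot (D s *m z s - A^T *m y s) (M s *m y s)
     + dot (y s) ((A *m M s + M s *m A^T - M s *m D s *m M s + S) *m y s)
     + dot (y s) (M s *m (D s *m z s - A^T *m y s)).
  have df s : t0 <= s <= t0 + T -> rderiv 0 f s (f' s).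
    move=> /andP[hs _]; have s0' : 0 <= s by exact: le_trans hs.
    exact: (rderiv_form (dM s0') (dy s hs) (dy s hs)).
  have bf s : t0 <= s <= t0 + T -> f' s <= K * dot c c.
    move=> hs; have s0' : 0 <= s by lra.
    apply: le_trans (riccati_dual A S (y s) (z s) (riccati_sym s0') (sD s0') (pD s0')) _.
    have hy : dot (y s) (y s) <= y2 * dot c c.
      by apply: mul_bound; apply: entries_leM; [exact: Fbd|exact: Gbd].
    have hz : dot (z s) (z s) <= z2 * dot c c by apply: mul_bound; exact: Ebd.
    have h1 := le_trans (ler_norm _) (form_bound (y s) (y s) cS0 hS).
    have h2 := le_trans (ler_norm _) (form_bound (z s) (z s) bD0 (hbD s0')).
    have h3 : cS' * k%:R * (dot (y s) (y s)) <= cS' * k%:R * (y2 * dot c c).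
      by rewrite ler_wpM2l // mulr_ge0.
    have h4 : bD * k%:R * (dot (z s) (z s)) <= bD * k%:R * (z2 * dot c c).
      by rewrite ler_wpM2l // mulr_ge0.
    apply: le_trans (lerD h1 h2) _; rewrite /K; lra.
  have tT : t0 <= t0 + T by rewrite lerDl ltW.
  have := rderiv_growth t00 tT df bf.
  have y00 : y t0 = 0 by rewrite /y G0 mulmx0 mul0mx.
  rewrite /f y00 mulmx0 dot0r subr0.
  have tTT : t0 + T - t0 = T by rewrite addrAC subrr add0r.
  by rewrite /y tTT mulrAC.
have [m1 m10 hm1] := riccati_bounded_on (ltW T0).
pose q2 := e ^+ 2 * (k * k)%:R.
have q20 : 0 <= q2 by rewrite /q2 mulr_ge0 ?sqr_ge0.
(* One summand for the times before [T], one for the later times, and 1 for strict positivity. *)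
pose m := m1 * k%:R * 2 + K * T * (q2 / g ^+ 2) + 1.
have p1 : 0 <= m1 * k%:R * 2 by rewrite !mulr_ge0.
have p2 : 0 <= K * T * (q2 / g ^+ 2).
  by rewrite !mulr_ge0 // ?(ltW T0) // invr_ge0 sqr_ge0.
exists m; first by rewrite /m; lra.
move=> t t00 y; have yy := dot_ge0 y; have [tT|/ltW Tt] := leP t T.
  have ht : 0 <= t <= T by rewrite t00.
  have := le_trans (ler_norm _) (form_bound y y m10 (hm1 t ht)).
  move=> /le_trans; apply; rewrite /m.
  have := mulr_ge0 p2 yy; nra.
have t0' : 0 <= t - T by rewrite subr_ge0.
have [G [G0 dG cG]] := obs _ t0'.
have tTK : t - T + T = t by rewrite subrK.
(* The final state [(1 - T A^T) G c] has to be [y]; by [flow_adjoint] this amounts to [G c = q]. *)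
pose q := (1%:M + T *: A)^T *m y.
pose c := invmx (G t) *m q.
rewrite tTK in cG.
have uG := coercive_unit g0 cG.
have Gc : G t *m c = q by rewrite /c mulKVmx.
have := ctrl _ c G t0' G0 dG; rewrite tTK /= -mulmxA Gc /q mulmxA flow_adjoint // mul1mx.
move=> /le_trans; apply.
have hq : dot q q <= q2 * dot y y.
  apply: mul_bound; apply: entries_le_tr; apply: flow_entries => //.
  by rewrite lexx ltW.
(* Coercivity of the Gramian gives [g |c|^2 <= c . q], hence [|c| <= |q| / g]. *)
have hc : dot c c <= q2 / g ^+ 2 * dot y y.
  have h1 := cG c; rewrite Gc in h1.
  have h2 := dot_CS c q; have cc := dot_ge0 c.
  have h3 : (g * dot c c) ^+ 2 <= dot c c * dot q q.
    by apply: le_trans h2; rewrite lerXn2r ?nnegrE ?(le_trans _ h1) // mulr_ge0 // ltW.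
  have [c0|c0] := eqVneq (dot c c) 0.
    by rewrite c0 mulr_ge0 // divr_ge0 ?sqr_ge0.
  have c1 : 0 < dot c c by rewrite lt_def c0.
  have h4 : g ^+ 2 * dot c c <= dot q q.
    by rewrite -(ler_pM2l c1); apply: le_trans h3; rewrite le_eqVlt; apply/orP; left; apply/eqP; ring.
  rewrite mulrAC ler_pdivlMr ?exprn_gt0 // mulrC; exact: le_trans h4 hq.
have KT : 0 <= K * T by rewrite mulr_ge0 // ltW.
apply: le_trans (ler_wpM2l KT hc) _.
rewrite mulrA; apply: ler_wpM2r => //; rewrite /m; lra.
Qed.

Lemma observer_decay (m kappa : R) : 0 < m ->
  (forall t, 0 <= t -> forall y, dot y (M t *m y) <= m * dot y y) ->
  1 / 2 <= kappa ->
  exists2 c, 0 < c & forall (t0 : R) (x : R -> 'cV[R]_k), 0 <= t0 ->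
    (forall t, t0 <= t ->
       deriv_from t0 x t ((A - kappa *: (M t *m D t)) *m x t)) ->
    forall t, t0 <= t ->
      dot (x t) (x t) <= c * expR (- (s0 / m) * (t - t0)) * dot (x t0) (x t0).
Proof.
move=> m0 hm hk; have [l l0 hl] := riccati_lower.
exists (m / l); first by rewrite divr_gt0.
move=> t0 x t00 dx t t0t.
have pos s : t0 <= s -> 0 <= s by exact: le_trans.
have uM s : t0 <= s -> M s \in unitmx by move=> hs; apply: coercive_unit l0 (hl s (pos s hs)).
pose W s := invmx (M s).
have sW s : t0 <= s -> (W s)^T = W s.
  by move=> hs; rewrite /W trmx_inv riccati_sym // pos.
have MWx s y : t0 <= s -> M s *m (W s *m y) = y by move=> hs; rewrite mulKVmx // uM.
pose V s := dot (x s) (W s *m x s).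
have VE s : t0 <= s -> V s = dot (W s *m x s) (M s *m (W s *m x s)).
  by move=> hs; rewrite MWx // dotC.
have Vz s : t0 <= s -> l * dot (W s *m x s) (W s *m x s) <= V s.
  by move=> hs; rewrite VE //; apply: hl; exact: pos.
have V0 s : t0 <= s -> 0 <= V s.
  by move=> hs; apply: le_trans (Vz s hs); rewrite mulr_ge0 ?dot_ge0 // ltW.
pose x' s := (A - kappa *: (M s *m D s)) *m x s.
pose V' s := dot (x' s) (W s *m x s)
    + dot (x s) (- (W s *m (A *m M s + M s *m A^T - M s *m D s *m M s + S) *m W s) *m x s)
    + dot (x s) (W s *m x' s).
have dV s : t0 <= s <= t -> rderiv t0 V s (V' s).
  move=> /andP[hs _]; apply: rderiv_form; [|exact: dx|exact: dx].
  apply: (deriv_from_invmx (w := l^-1)) => //.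
    by move=> r hr; apply: coercive_invmx_entries => //; apply: hl; exact: pos.
  by apply: deriv_from_sub t00 _; apply: dM; exact: pos.
(* With [z = M^-1 x], the dissipation is at least [s0 |z|^2], while [V = z^T M z <= m |z|^2]. *)
have V'le s : t0 <= s <= t -> V' s <= - (s0 / m) * V s.
  move=> /andP[hs _]; have s0' := pos s hs.
  apply: le_trans (lyapunov_decrease A S (x s) (riccati_sym s0') (sW s hs) _ _ (pD s0') hk) _.
  - exact: mulmxV (uM s hs).
  - exact: mulVmx (uM s hs).
  have h1 := cS (W s *m x s); have h2 := hm s s0' (W s *m x s).
  rewrite -VE // in h2; rewrite mulNr lerN2; apply: le_trans h1.
  rewrite mulrAC ler_pdivrMr // -mulrA ler_wpM2l ?(ltW s00) //. by rewrite mulrC.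
have Vt := rderiv_gronwall (lexx t0) t0t dV V'le.
(* Cauchy-Schwarz for the form [M], applied to [x] and [M^-1 x], gives [|x|^4 <= (x^T M x) V]. *)
have up s : t0 <= s -> dot (x s) (x s) <= m * V s.
  move=> hs; have s0' := pos s hs.
  have h1 := psd_CS (x s) (W s *m x s) (riccati_sym s0')
     (fun y => le_trans (mulr_ge0 (ltW l0) (dot_ge0 y)) (hl s s0' y)).
  rewrite -VE // MWx // in h1.
  have [x0|x0] := eqVneq (dot (x s) (x s)) 0; first by rewrite x0 mulr_ge0 ?V0 // ltW.
  have x1 : 0 < dot (x s) (x s) by rewrite lt_def x0 dot_ge0.
  rewrite -(ler_pM2l x1) -expr2; apply: le_trans h1 _.
  by rewrite mulrCA mulrA ler_wpM2r ?V0 // hm.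
(* Here [V^2 <= |x|^2 |M^-1 x|^2], and the last factor is at most [V / l]. *)
have low s : t0 <= s -> V s <= dot (x s) (x s) / l.
  move=> hs; have h1 := dot_CS (x s) (W s *m x s); rewrite -/(V s) in h1.
  have [v0|v0] := eqVneq (V s) 0; first by rewrite v0 divr_ge0 ?dot_ge0 // ltW.
  have v1 : 0 < V s by rewrite lt_def v0 V0.
  rewrite ler_pdivlMr // -(ler_pM2l v1).
  have h2 := ler_wpM2l (dot_ge0 (x s)) (Vz s hs).
  nra.
apply: le_trans (up t t0t) _; rewrite -!mulrA ler_pM2l //.
apply: le_trans Vt _; rewrite mulrC mulrCA ler_pM2l ?expR_gt0 // mulrC.
exact: low.
Qed.

End Riccati.

(** * Uniform observability *)

Section ContinuousMatrices.
Context {R : realType}.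

Definition mcont_from0 a b (F : R -> 'M[R]_(a, b)) : Prop :=
  forall i j, cont_from 0 (fun s => F s i j).

Lemma mcont_cvg a b (F : R -> 'M[R]_(a, b)) : mcont_from0 F <->
  forall t : R, 0 <= t -> F s @[s --> within `[0, +oo[ (nbhs t)] --> F t.
Proof.
split=> [h t t0|h i j t t0]; first by apply/cvg_mxP => i j; exact: h.
by have := h t t0; rewrite cvg_mxP; apply.
Qed.

Lemma mcont_cst a b (X : 'M[R]_(a, b)) : mcont_from0 (fun=> X).
Proof. by move=> i j t t0; exact: cvg_cst. Qed.

Lemma mcontM a b c (F : R -> 'M[R]_(a, b)) (G : R -> 'M[R]_(b, c)) :
  mcont_from0 F -> mcont_from0 G -> mcont_from0 (fun s => F s *m G s).
Proof.
move=> /mcont_cvg hF /mcont_cvg hG; apply/mcont_cvg => t t0.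
by apply: cvg_mulmx; [exact: hF|exact: hG].
Qed.

Lemma mcontD a b (F G : R -> 'M[R]_(a, b)) :
  mcont_from0 F -> mcont_from0 G -> mcont_from0 (fun s => F s + G s).
Proof.
move=> hF hG i j t t0; under eq_cvg do rewrite mxDE; rewrite mxDE.
by apply: cvgD; [exact: hF|exact: hG].
Qed.

Lemma mcontN a b (F : R -> 'M[R]_(a, b)) :
  mcont_from0 F -> mcont_from0 (fun s => - F s).
Proof.
move=> hF i j t t0; under eq_cvg do rewrite mxNE; rewrite mxNE.
by apply: cvgN; exact: hF.
Qed.

Lemma mcont_tr a b (F : R -> 'M[R]_(a, b)) :
  mcont_from0 F -> mcont_from0 (fun s => (F s)^T).
Proof.
by move=> hF i j t t0; under eq_cvg do rewrite mxTE; rewrite mxTE; exact: hF.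
Qed.

Lemma mcont_deriv a b (F F' : R -> 'M[R]_(a, b)) :
  (forall t, 0 <= t -> deriv_from 0 F t (F' t)) -> mcont_from0 F.
Proof. by move=> h i j; exact: deriv_from_cont h. Qed.

Lemma mx_primitive a b (F : R -> 'M[R]_(a, b)) : mcont_from0 F ->
  exists G : R -> 'M[R]_(a, b), forall t, 0 <= t -> deriv_from 0 G t (F t).
Proof.
move=> hF.
have /fin_all_exists[g hg] : forall ij : 'I_a * 'I_b, exists g : R -> R,
    forall t, 0 <= t -> rderiv 0 g t (F t ij.1 ij.2).
  by move=> ij; apply: primitive_from0; exact: hF.
exists (fun s => \matrix_(i, j) g (i, j) s) => t t0; apply/deriv_fromP => i j.
rewrite (_ : (fun s => _) = g (i, j)); first exact: (hg (i, j)).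
by apply/funext => s; rewrite mxE.
Qed.

End ContinuousMatrices.

(** * Uniform coercivity of the observability Gramian *)

Section Gramian.
Context {R : realType} (N : nat).

Lemma dot_col (a b c d : 'cV[R]_N) : dot (col_mx a b) (col_mx c d) = dot a c + dot b d.
Proof. by rewrite /dot tr_col_mx mul_row_col mxDE. Qed.

Let A : 'M[R]_(N + N) := block_mx 0 1%:M 0 0.

Lemma flow_col (h : R) (a b : 'cV[R]_N) :
  (1%:M + h *: A) *m col_mx a b = col_mx (a + h *: b) b.
Proof.
rewrite mulmxDl mul1mx -scalemxAl mul_block_col !mul0mx mul1mx add0r addr0.
by rewrite scale_col_mx scaler0 add_col_mx addr0.
Qed.

Variables (P Pi : R -> 'M[R]_N) (Q : 'M[R]_N) (b q T mu : R).
Hypotheses (b0 : 0 <= b) (q0 : 0 < q) (T0 : 0 < T) (mu0 : 0 < mu).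
Hypothesis cP : mcont_from0 P.
Hypothesis bP : forall t, 0 <= t -> entries_le (P t) b.
Hypothesis cQ : coercive Q q.
Hypothesis dPi : forall t, 0 <= t -> deriv_from 0 Pi t (P t).
Hypothesis excite : forall t, 0 <= t -> coercive (Pi (t + T) - Pi t) (T * mu).

Let C t : 'M[R]_(N, N + N) := row_mx (P t) 0.
Let D t := (C t)^T *m Q *m C t.

(** Threshold for the ratio of [|z|] to the slope [|x2|]: above it, the drift of [z] during a window
    of length [T] cannot cancel the excitation. The constant [K] is then the growth of the output
    energy over that window, per unit of [|z|^2]. *)
Let r := 4 * b * N%:R * T / mu + 1.
Let K := q * T * mu ^+ 2 / 4.

Let r0 : 0 < r.
Proof. by rewrite /r ltr_wpDl // divr_ge0 ?(ltW mu0) // !mulr_ge0 // ltW. Qed.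

Let K0 : 0 < K.
Proof. by rewrite /K divr_gt0 // !mulr_gt0 // exprn_gt0. Qed.

(* [|P z|^2 >= 2 e w . P z - e^2 |w|^2] with [e = mu / 2] and [w] the value of
   [z] at the left end of the window *)
Lemma window_growth (a : R) (z0 x2 : 'cV[R]_N) (phi phi' : R -> R) : 0 <= a ->
  r ^+ 2 * dot x2 x2 <= dot z0 z0 ->
  (forall s, a <= s <= a + T -> rderiv 0 phi s (phi' s)) ->
  (forall s, a <= s <= a + T ->
     q * dot (P s *m (z0 + (s - a) *: x2)) (P s *m (z0 + (s - a) *: x2)) <= phi' s) ->
  K * dot z0 z0 <= phi (a + T) - phi a.
Proof.
move=> a0 hr dphi hphi.
(* Subtracting the linear part of the lower bound leaves a function whose derivative is at least
   [- (3/4) q mu^2 |z0|^2]: one quarter comes from the square [e^2 |z0|^2] and one half from the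
   drift. Excitation returns [q mu^2 T |z0|^2], hence the factor 1/4 in [K]. *)
pose psi s := phi s + - (q * mu) * dot z0 (Pi s *m z0).
have dpsi s : a <= s <= a + T -> rderiv 0 psi s
    (phi' s + (0 * dot z0 (Pi s *m z0) + - (q * mu) *
      (dot 0 (Pi s *m z0) + dot z0 (P s *m z0) + dot z0 (Pi s *m 0)))).
  move=> hs; have s0 : 0 <= s by case/andP: hs => + _; exact: le_trans.
  apply: rderivD; first exact: dphi.
  apply: rderivM; first exact: rderiv_cst.
  by apply: rderiv_form; [exact: dPi|exact: deriv_from_cst|exact: deriv_from_cst].
have aT : a <= a + T by rewrite lerDl ltW.
have zz := dot_ge0 z0.
have lb s : a <= s <= a + T -> - (q * (3 / 4) * mu ^+ 2 * dot z0 z0) <=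
    phi' s + (0 * dot z0 (Pi s *m z0) + - (q * mu) *
      (dot 0 (Pi s *m z0) + dot z0 (P s *m z0) + dot z0 (Pi s *m 0))).
  move=> hs; have s0 : 0 <= s by case/andP: hs => + _; exact: le_trans.
  rewrite mulmx0 dot0r (dotC 0) dot0r add0r addr0 mul0r add0r.
  have h1 := hphi s hs; set h := s - a in h1.
  have h0 : 0 <= h <= T by rewrite /h; lra.
  set Pz := P s *m (z0 + h *: x2) in h1.
  have h2 := dot_ge0 (Pz - (mu / 2) *: z0).
  rewrite dotBl !dotBr !dotZl !dotZr in h2.
  have e1 : dot z0 Pz = dot z0 (P s *m z0) + h * dot z0 (P s *m x2).
    by rewrite /Pz mulmxDr dotDr -scalemxAr dotZr.
  rewrite (dotC Pz z0) e1 in h2.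
  (* Rescaling [x2] by [r] makes both arguments no longer than [z0]. *)
  have h3 := form_bound z0 (r *: x2) b0 (bP s0).
  rewrite -scalemxAr !dotZr dotZl mulrA -expr2 in h3.
  set y := dot z0 (P s *m x2) in h2 h3.
  have h4 : r * `|y| <= b * N%:R * (2 * dot z0 z0).
    rewrite -[X in X * `|y|](gtr0_norm r0) -normrM; apply: le_trans h3 _.
    by rewrite ler_wpM2l ?mulr_ge0 //; lra.
  have h5 : T * `|y| <= mu / 2 * dot z0 z0.
    rewrite -(ler_pM2l r0).
    have -> : r * (T * `|y|) = T * (r * `|y|) by ring.
    apply: le_trans (ler_wpM2l (ltW T0) h4) _.
    have -> : T * (b * N%:R * (2 * dot z0 z0)) = (4 * b * N%:R * T / mu) * (mu / 2 * dot z0 z0).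
      by field; rewrite lt0r_neq0.
    apply: ler_wpM2r; first by rewrite mulr_ge0 // ltW // divr_gt0.
    by rewrite /r lerDl.
  have h6 : - (mu / 2 * dot z0 z0) <= h * y.
    rewrite lerNl; apply: le_trans h5; apply: le_trans (ler_norm _) _.
    rewrite normrN normrM ler_wpM2r // ger0_norm; lra.
  have h7 := ler_wpM2l (ltW mu0) h6.
  set u := dot Pz Pz in h1 h2; set v := dot z0 (P s *m z0) in h2 *.
  set w := dot z0 z0 in h2 h7 *.
  have h8 : mu * v - 3 / 4 * mu ^+ 2 * w <= u by lra.
  have h9 := ler_wpM2l (ltW q0) h8.
  lra.
have := rderiv_growth_ge a0 aT dpsi lb.
have aTa : a + T - a = T by rewrite addrAC subrr add0r.
rewrite aTa /psi => h1.
have := excite a0 z0; rewrite mulmxBl dotBr => h2.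
have h3 := ler_wpM2l (ltW (mulr_gt0 q0 mu0)) h2.
rewrite /K; lra.
Qed.

Lemma gramian_coercive : exists T2 g : R, [/\ 0 < T2, 0 < g &
  forall t0, 0 <= t0 -> exists G : R -> 'M[R]_(N + N),
    [/\ G t0 = 0,
        forall s, t0 <= s -> deriv_from 0 G s
          ((1%:M + (s - t0) *: A)^T *m D s *m (1%:M + (s - t0) *: A))
      & coercive (G (t0 + T2)) g]].
Proof.
(* The two windows start at [t0] and [t0 + 2 r]. On the one that is used, [|x1|^2 <= |z|^2] and
   [r^2 |x2|^2 <= |z|^2] at its left end, which gives the second factor of the constant. *)
exists (2 * r + T), (K * (r ^+ 2 / (r ^+ 2 + 1))).
have r2 : 0 < r ^+ 2 by rewrite exprn_gt0.
have r21 : 0 < r ^+ 2 + 1 by lra.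
split; first by rewrite addr_gt0 // mulr_gt0.
  by rewrite mulr_gt0 // divr_gt0.
move=> t0 t00.
pose E s : 'M[R]_(N + N) := 1%:M + (s - t0) *: A.
have cE : mcont_from0 E.
  by apply: (mcont_deriv (F' := fun=> A)) => t _; exact: deriv_from_affine.
have cC : mcont_from0 C.
  move=> i j t ht; rewrite /C; case: (split_ordP j) => l ->.
    by under eq_cvg do rewrite row_mxEl; rewrite row_mxEl; exact: cP.
  by under eq_cvg do rewrite row_mxEr; rewrite row_mxEr; exact: cvg_cst.
have cD : mcont_from0 (fun s => (E s)^T *m D s *m E s).
  apply: (mcontM _ cE); apply: mcontM; first exact: mcont_tr.
  by apply: (mcontM _ cC); apply: mcontM; [exact: mcont_tr|exact: mcont_cst].
have [G dG] := mx_primitive cD.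
exists (fun s => G s - G t0); split; first exact: subrr.
  move=> s hs; have s0 : 0 <= s by exact: le_trans hs.
  have := deriv_fromB (dG s s0) (deriv_from_cst 0 (G t0) s); rewrite subr0; exact.
move=> x; rewrite -(vsubmxK x); set x1 := usubmx x; set x2 := dsubmx x.
rewrite mulmxBl dotBr dot_col.
pose X := col_mx x1 x2; rewrite -/X.
pose phi s := dot X (G s *m X).
pose z s := x1 + (s - t0) *: x2.
pose phi' s := dot (P s *m z s) (Q *m (P s *m z s)).
have dphi s : t0 <= s -> rderiv 0 phi s (phi' s).
  move=> hs; have s0 : 0 <= s by exact: le_trans hs.
  have := rderiv_form (dG s s0) (deriv_from_cst 0 X s) (deriv_from_cst 0 X s).
  rewrite mulmx0 dot0r (dotC 0) dot0r add0r addr0 /D -!mulmxA flow_col dot_mulT.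
  by rewrite flow_col dot_mulT /C mul_row_col mul0mx addr0.
have phi'q s : q * dot (P s *m z s) (P s *m z s) <= phi' s by exact: cQ.
have phi'0 s : 0 <= phi' s.
  by apply: le_trans (phi'q s); rewrite mulr_ge0 ?dot_ge0 // ltW.
have mono a1 a2 : t0 <= a1 -> a1 <= a2 -> phi a1 <= phi a2.
  move=> h1 h2; have a10 : 0 <= a1 by exact: le_trans h1.
  have H s : a1 <= s <= a2 -> rderiv 0 phi s (phi' s).
    by move=> /andP[hs _]; apply: dphi; exact: le_trans hs.
  have := rderiv_growth_ge a10 h2 H (fun s _ => phi'0 s).
  by rewrite mul0r subr_ge0.
have grow a : t0 <= a -> r ^+ 2 * dot x2 x2 <= dot (z a) (z a) ->
    K * dot (z a) (z a) <= phi (a + T) - phi a.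
  move=> ha hz; have a0 : 0 <= a by exact: le_trans ha.
  apply: (window_growth (phi' := phi')) hz _ _ => // s /andP[hs _].
    by apply: dphi; exact: le_trans hs.
  have -> : z a + (s - a) *: x2 = z s.
    by rewrite /z -addrA -scalerDl; congr (_ + _ *: _); ring.
  exact: phi'q.
have tot a : t0 <= a -> a <= t0 + 2 * r -> dot x1 x1 + dot x2 x2 <= (r ^+ 2 + 1) / r ^+ 2 * dot (z a) (z a) ->
    r ^+ 2 * dot x2 x2 <= dot (z a) (z a) ->
    K * (r ^+ 2 / (r ^+ 2 + 1)) * (dot x1 x1 + dot x2 x2) <= phi (t0 + (2 * r + T)) - phi t0.
  move=> ta ar hx hz; have h1 := grow a ta hz.
  have h2 := mono _ _ (lexx t0) ta.
  have h3 : phi (a + T) <= phi (t0 + (2 * r + T)) by apply: mono; [rewrite (le_trans ta) // lerDl ltW|rewrite addrA lerD2r].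
  apply: (le_trans (y := K * dot (z a) (z a))); last by lra.
  rewrite -mulrA; apply: ler_wpM2l; first exact: ltW.
  move: hx; rewrite mulrAC ler_pdivlMr // [leLHS]mulrC => hx.
  by rewrite mulrAC ler_pdivrMr // [leRHS]mulrC.
rewrite -/(phi (t0 + (2 * r + T))) -/(phi t0).
have [h|/ltW h] := leP (r ^+ 2 * dot x2 x2) (dot x1 x1).
  apply: (tot t0) => //.
  - by rewrite lerDl mulr_ge0 // ltW.
  - rewrite /z subrr scale0r addr0 mulrAC ler_pdivlMr //; lra.
  - by rewrite /z subrr scale0r addr0.
(* By the parallelogram law for [z] and [x1], whose difference is [2 r x2],
   [|z|^2 + |x1|^2 >= 2 r^2 |x2|^2], and here [|x1|^2 <= r^2 |x2|^2]. *)
have hz : r ^+ 2 * dot x2 x2 <= dot (z (t0 + 2 * r)) (z (t0 + 2 * r)).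
  have -> : z (t0 + 2 * r) = x1 + (2 * r) *: x2.
    by rewrite /z; congr (_ + _ *: _); ring.
  have := dot_ge0 (x1 + x1 + (2 * r) *: x2).
  rewrite !dotDl !dotDr !dotZl !dotZr (dotC x2 x1); lra.
apply: (tot (t0 + 2 * r)) => //.
  by rewrite lerDl mulr_ge0 // ltW.
rewrite mulrAC ler_pdivlMr //.
have := ler_wpM2l (ltW r21) hz; have := dot_ge0 x2; have := dot_ge0 x1.
nra.
Qed.

End Gramian.

(** * The bearing Laplacian *)

Lemma connect_invariant (T : finType) (U : Type) (e : rel T) (f : T -> U) :
  (forall a b, e a b -> f a = f b) -> forall a b, connect e a b -> f a = f b.
Proof.
move=> h a b /connectP[s + ->]; elim: s a => //= c s IH a /andP[/h -> /IH].
exact.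
Qed.

(** * Block coordinates and the Laplacian augmented by the leader term *)

Section Blocks.
Context {R : realType} (n d : nat).

Lemma sum_mxtens (F : 'I_(n * d) -> R) :
  \sum_k F k = \sum_i \sum_j F (mxtens_index (i, j)).
Proof.
rewrite pair_big /=; apply: (reindex (fun ij => mxtens_index (ij.1, ij.2))).
by exists (fun k => mxtens_unindex k) => [[i j]|k] _; rewrite ?mxtens_indexK // -surjective_pairing mxtens_unindexK.
Qed.

Lemma blkdiagE (X : 'I_n -> 'M[R]_d) i a j b :
  blkdiag X (mxtens_index (i, a)) (mxtens_index (j, b)) = (i == j)%:R * X i a b.
Proof.
rewrite /blkdiag summxE (bigD1 i) //= tensmxE mxE eqxx /= eq_sym big1 ?addr0 // => l li.
by rewrite tensmxE mxE eq_sym (negbTE li) mul0r.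
Qed.

Lemma sysC1_dot (x : 'cV[R]_(n * d)) : dot x (sysC1 n d *m x) =
  \sum_i \sum_a (val i == 0%N)%:R * x (mxtens_index (i, a)) 0 ^+ 2.
Proof.
rewrite dotE sum_mxtens; apply: eq_bigr => i _; apply: eq_bigr => a _.
rewrite mxME sum_mxtens (bigD1 i) //= [X in _ + X]big1 ?addr0; last first.
  by move=> j ji; apply: big1 => b _; rewrite blkdiagE eq_sym (negbTE ji) !mul0r.
rewrite (bigD1 a) //= big1 ?addr0; last first.
  move=> b ba; rewrite blkdiagE; case: ifP => _; rewrite !mxE ?mulr0 ?mul0r //.
  by rewrite eq_sym (negbTE ba) mulr0 mul0r.
rewrite blkdiagE eqxx mul1r; case: (val i == 0%N); rewrite !mxE ?eqxx /=; ring.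
Qed.

Lemma sysC1_sym : (sysC1 n d : 'M[R]_(n * d))^T = sysC1 n d.
Proof.
apply/matrixP => k l; rewrite mxTE.
case: (mxtens_indexP k) => i a; case: (mxtens_indexP l) => j b.
rewrite !blkdiagE eq_sym; case: eqVneq => [->|]; rewrite ?mul0r // !mul1r.
by case: ifP => _; rewrite !mxE // eq_sym.
Qed.

Lemma incidence_barE m (tl hd : 'I_m -> 'I_n) (x : 'cV[R]_(n * d)) k a :
  (incidence_bar d tl hd *m x) (mxtens_index (k, a)) 0 =
  x (mxtens_index (hd k, a)) 0 - x (mxtens_index (tl k, a)) 0.
Proof.
rewrite mxME sum_mxtens.
under eq_bigr => i _.
  rewrite (bigD1 a) //= big1 => [|b ba]; last first.
    by rewrite tensmxE [1%:M _ _]mxE eq_sym (negbTE ba) mulr0 mul0r.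
  rewrite addr0 tensmxE [1%:M _ _]mxE eqxx mulr1 mxE mulrBl.
  over.
rewrite sumrB (bigD1 (hd k)) //= eqxx mul1r big1 ?addr0 => [|i ik].
  rewrite (bigD1 (tl k)) //= eqxx mul1r big1 ?addr0 // => i ik.
  by rewrite (negbTE ik) mul0r.
by rewrite (negbTE ik) mul0r.
Qed.

(** Both terms are nonnegative. If the Laplacian term vanishes, all agents of a connected graph
    share one position, and the leader term forces that position to be 0. *)
Lemma leader_laplacian_pdmx m (e : rel 'I_n) (tl hd : 'I_m -> 'I_n) (mu : R) :
  (0 < n)%N -> 0 < mu -> oriented_edges e tl hd -> graph_connected e ->
  pdmx (mu *: laplacian d tl hd + sysC1 n d).
Proof.
move=> n0 mu0 [_ _ cov] conn; split.
  by rewrite mxtrD mxtrZ sysC1_sym /laplacian trmx_mul trmxK.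
move=> x x0; rewrite quadE mulmxDl dotDr -scalemxAl dotZr.
pose H : 'M[R]_(m * d, n * d) := incidence_bar d tl hd.
have -> : dot x (laplacian d tl hd *m x) = dot (H *m x) (H *m x).
  by rewrite /laplacian -mulmxA dot_mulT.
have hL := dot_ge0 (H *m x).
have hC : 0 <= dot x (sysC1 n d *m x).
  by rewrite sysC1_dot; do 2!apply: sumr_ge0 => ? _; rewrite mulr_ge0 ?sqr_ge0.
rewrite lt_def addr_ge0 ?mulr_ge0 ?(ltW mu0) // andbT; apply: contra x0.
rewrite paddr_eq0 ?mulr_ge0 ?(ltW mu0) // mulf_eq0 (gt_eqF mu0) /=.
move=> /andP[/eqP /dot_eq0 Hx0 /eqP Cx0].
have edge i j : e i j -> (fun a => x (mxtens_index (i, a)) 0) = (fun a => x (mxtens_index (j, a)) 0).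
  move=> /cov[k hk]; apply/funext => a.
  have := incidence_barE tl hd x k a; rewrite -/H Hx0 mxE => /esym/eqP; rewrite subr_eq0 => /eqP heq.
  have : i \in [set tl k; hd k]%SET by rewrite hk !inE eqxx.
  have : j \in [set tl k; hd k]%SET by rewrite hk !inE eqxx orbT.
  by rewrite !inE => /orP[] /eqP -> /orP[] /eqP ->.
pose i0 := Ordinal n0.
have z0 a : x (mxtens_index (i0, a)) 0 = 0.
  move: Cx0; rewrite sysC1_dot => /eqP; rewrite psumr_eq0; last first.
    by move=> i _; apply: sumr_ge0 => ? _; rewrite mulr_ge0 ?sqr_ge0.
  move=> /allP /(_ i0 (mem_index_enum _)) /=; rewrite psumr_eq0; last first.
    by move=> ? _; rewrite mulr_ge0 ?sqr_ge0.
  by move=> /allP /(_ a (mem_index_enum _)) /=; rewrite mul1r sqrf_eq0 => /eqP.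
apply/eqP/colP => k; rewrite mxE; case: (mxtens_indexP k) => i a.
have := connect_invariant edge (conn i i0) => /(congr1 (fun f => f a)) ->.
exact: z0.
Qed.

Lemma deriv_from_stack (t0 t : R) (x : 'I_n -> R -> 'cV[R]_d) x' :
  (forall i, deriv_from t0 (x i) t (x' i)) ->
  deriv_from t0 (fun s => stack (fun i => x i s)) t (stack x').
Proof.
move=> h; apply/deriv_fromP => k j; rewrite mxE.
rewrite (_ : (fun s => _) = fun s => x (mxtens_unindex k).1 s (mxtens_unindex k).2 0).
  by have /deriv_fromP := h (mxtens_unindex k).1; apply.
by apply/funext => s; rewrite mxE.
Qed.

Lemma deriv_from_col (t0 t : R) a b (x : R -> 'cV[R]_a) (y : R -> 'cV[R]_b) x' y' :
  deriv_from t0 x t x' -> deriv_from t0 y t y' ->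
  deriv_from t0 (fun s => col_mx (x s) (y s)) t (col_mx x' y').
Proof.
move=> /deriv_fromP hx /deriv_fromP hy; apply/deriv_fromP => i j.
case: (split_ordP i) => l ->.
  rewrite col_mxEu (_ : (fun s => _) = fun s => x s l j); first exact: hx.
  by apply/funext => s; rewrite col_mxEu.
rewrite col_mxEd (_ : (fun s => _) = fun s => y s l j); first exact: hy.
by apply/funext => s; rewrite col_mxEd.
Qed.

End Blocks.

(** * Boundedness, continuity and integral of the bearing Laplacian *)

Section BearingLaplacian.
Context {R : realType} (n m d : nat).
Variables (tl hd : 'I_m -> 'I_n) (p : 'I_n -> R -> 'cV[R]_d).

Lemma bearing_entries (q : 'I_n -> 'cV[R]_d) i j : entries_le (bearing q i j) 1.
Proof.
move=> a b; rewrite ord1 mxE; set y := q j - q i.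
(* For coincident agents the default [0^-1 = 0] makes the bearing zero, so the bound holds for every
   configuration. *)
have [y0|y0] := eqVneq (enorm y) 0; first by rewrite y0 invr0 mul0r normr0.
have ey : 0 < enorm y by rewrite lt_def y0 /enorm sqrtr_ge0.
rewrite normrM gtr0_norm ?invr_gt0 // ler_pdivrMl // mulr1 enormE.
rewrite -sqrtr_sqr ler_wsqrtr // dotE (bigD1 a) //= -expr2 lerDl.
by apply: sumr_ge0 => l _; rewrite -expr2 sqr_ge0.
Qed.

Lemma blkdiag_entries k (X : 'I_k -> 'M[R]_d) (c : R) : 0 <= c ->
  (forall i, entries_le (X i) c) -> entries_le (blkdiag X) c.
Proof.
move=> c0 hX x y; case: (mxtens_indexP x) => i a; case: (mxtens_indexP y) => j b.
by rewrite blkdiagE; case: eqP => _; rewrite ?mul1r ?mul0r ?normr0 //; exact: hX.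
Qed.

Lemma bearing_laplacian_bounded : exists2 c, 0 <= c &
  forall q : 'I_n -> 'cV[R]_d, entries_le (bearing_laplacian tl hd q + sysC1 n d) c.
Proof.
have [h h0 hh] := entries_exists (incidence_bar d tl hd : 'M[R]_(_, _)).
have [c c0 hc] := entries_exists (sysC1 n d : 'M[R]_(n * d)).
pose w : R := 1 + 1 * 1 *+ 1.
have w0 : 0 <= w by rewrite addr_ge0 // mulr1.
exists ((h * w *+ (m * d)) * h *+ (m * d) + c).
  by rewrite addr_ge0 // mulrn_wge0 // mulr_ge0 // mulrn_wge0 // mulr_ge0.
move=> q; apply: entries_leD => //.
apply: entries_leM => //; apply: entries_leM; first exact: entries_le_tr.
apply: blkdiag_entries => // k; apply: entries_leD; first exact: entries_le1.
by apply: entries_leN; apply: entries_leM; [|apply: entries_le_tr]; exact: bearing_entries.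
Qed.

Lemma blkdiag_mcont k (X : 'I_k -> R -> 'M[R]_d) :
  (forall i, mcont_from0 (X i)) -> mcont_from0 (fun s => blkdiag (fun i => X i s)).
Proof.
move=> hX x y t t0; case: (mxtens_indexP x) => i a; case: (mxtens_indexP y) => j b.
under eq_cvg do rewrite blkdiagE; rewrite blkdiagE.
by apply: cvgM; [exact: cvg_cst|exact: hX].
Qed.

(** Distinct positions keep the norm away from 0 at each time, where inversion is continuous. *)
Lemma mcont_bearing i j : (forall l, mcont_from0 (p l)) ->
  (forall t, 0 <= t -> p i t <> p j t) ->
  mcont_from0 (fun s => bearing (fun l => p l s) i j).
Proof.
move=> cp pij a b t t0; rewrite /bearing; under eq_cvg do rewrite mxZE; rewrite mxZE.
have cy : mcont_from0 (fun s => p j s - p i s) by apply: mcontD => //; exact: mcontN.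
apply: cvgM; last exact: cy.
have yt : p j t - p i t != 0 by rewrite subr_eq0; apply/eqP => /esym; exact: pij.
apply: cvgV.
  by rewrite enormE sqrtr_eq0 -ltNge dot_gt0.
under eq_cvg do rewrite enormE; rewrite enormE.
have cdot : mcont_from0 _ := mcontM (mcont_tr cy) cy.
have hdot := cdot 0 0 t t0.
exact: (cvg_comp _ _ hdot (@sqrt_continuous _ _)).
Qed.

Lemma mcont_bearing_laplacian : (forall l, mcont_from0 (p l)) ->
  (forall k t, 0 <= t -> p (tl k) t <> p (hd k) t) ->
  mcont_from0 (fun s => bearing_laplacian tl hd (fun i => p i s)).
Proof.
move=> cp pe; rewrite /bearing_laplacian; apply: mcontM; last exact: mcont_cst.
apply: mcontM; first exact: mcont_cst.
apply: blkdiag_mcont => k; rewrite /proj_orth.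
apply: mcontD; first exact: mcont_cst.
have cb : mcont_from0 _ := mcont_bearing cp (pe k).
by apply: mcontN; apply: mcontM => //; exact: mcont_tr.
Qed.

(** Turns the integral in the excitation condition into the increment of a primitive, the form used
    for the Gramian. *)
Lemma mxintegral_primitive a b (F G : R -> 'M[R]_(a, b)) (t0 t1 : R) :
  mcont_from0 F -> (forall t, 0 <= t -> deriv_from 0 G t (F t)) -> 0 <= t0 -> t0 < t1 ->
  mxintegral t0 t1 F = G t1 - G t0.
Proof.
move=> cF dG t00 t01; apply/matrixP => i j; rewrite mxE mxDE mxNE.
apply: (@FTC2_from0 _ (fun s => F s i j) (fun s => G s i j) _ _ t00 t01 (cF i j)) => t ht.
exact: (deriv_fromP _ _ _ _).1 (dG t ht) i j.
Qed.

End BearingLaplacian.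

Lemma enorm_exp_decay (R : realType) k (x y : 'cV[R]_k) (c l h : R) : 0 < c ->
  dot x x <= c * expR (- l * h) * dot y y ->
  enorm x <= Num.sqrt c * expR (- (l / 2) * h) * enorm y.
Proof.
move=> c0 hx; rewrite !enormE.
have -> : expR (- (l / 2) * h) = Num.sqrt (expR (- l * h)).
  have -> : - l * h = - (l / 2) * h + - (l / 2) * h by field.
  by rewrite expRD -expr2 sqrtr_sqr ger0_norm ?expR_ge0.
by rewrite -!sqrtrM ?mulr_ge0 ?expR_ge0 ?(ltW c0) // ler_wsqrtr.
Qed.

(** * Dynamics of the estimation error *)

Section ErrorDynamics.
Context {R : realType} (n m d : nat).
Variables (tl hd : 'I_m -> 'I_n) (p v u : 'I_n -> R -> 'cV[R]_d).
Variables (Q : 'M[R]_(n * d)) (M : R -> 'M[R]_(n * d + n * d)) (kappa : R).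

Let D (t : R) := (sysC tl hd p t)^T *m Q *m sysC tl hd p t.

(** The input [u] cancels in the difference, the innovation is [- C] times the error, and
    [K C = kappa M D]. *)
Lemma estimation_error_ode (t0 : R) (ph vh : 'I_n -> R -> 'cV[R]_d) : 0 <= t0 ->
  (forall i t, 0 <= t -> deriv_from 0 (p i) t (v i t)) ->
  (forall i t, 0 <= t -> deriv_from 0 (v i) t (u i t)) ->
  observer_solution tl hd p (gain tl hd p kappa Q M) v u t0 ph vh ->
  forall t, t0 <= t ->
    deriv_from t0 (estimation_error p v ph vh) t
      ((sysA n d - kappa *: (M t *m D t)) *m estimation_error p v ph vh t).
Proof.
move=> t00 hp hv obs t t0t; have ht : 0 <= t by exact: le_trans t0t.
pose x s := col_mx (stack (fun i => p i s)) (stack (fun i => v i s)).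
pose xh s := col_mx (stack (fun i => ph i s)) (stack (fun i => vh i s)).
have errE s : estimation_error p v ph vh s = xh s - x s.
  by rewrite /estimation_error /xh /x opp_col_mx add_col_mx.
have dx : deriv_from t0 x t (sysA n d *m x t + sysB n d *m stack (fun i => u i t)).
  rewrite /sysA /sysB /x mul_block_col mul_col_mx !mul0mx !mul1mx add0r addr0 add_col_mx.
  rewrite addr0 add0r; apply: deriv_from_col; apply: deriv_from_stack => i.
    exact: deriv_from_sub t00 (hp i t ht).
  exact: deriv_from_sub t00 (hv i t ht).
rewrite (_ : estimation_error p v ph vh = fun s => xh s - x s); last exact/funext.
have := deriv_fromB (obs t t0t) dx; rewrite -/(x t) -/(xh t); congr deriv_from.
rewrite /gain /D; move: (xh t) (x t) (sysC tl hd p t) (M t) (stack _) => a b C N w.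
by rewrite !(mulmxBr, mulmxBl) -?scalemxAl ?mulmxA; mxmodule.
Qed.

End ErrorDynamics.

Theorem theorem1 (R : realType) (d n m : nat) (hd2 : (2 <= d)%N) (hn2 : (2 <= n)%N)
    (e : rel 'I_n) (he : simple_graph e)
    (tl hd : 'I_m -> 'I_n) (hedges : oriented_edges e tl hd)
    (p v u : 'I_n -> R -> 'cV[R]_d)
    (hp : forall i t, 0 <= t -> deriv_from 0 (p i) t (v i t))
    (hv : forall i t, 0 <= t -> deriv_from 0 (v i) t (u i t))
    (hpb : forall i, bounded_ge0 (p i))
    (hvb : forall i, bounded_ge0 (v i))
    (hub : forall i, bounded_ge0 (u i))
    (hbearings : forall i j t, e i j -> 0 <= t -> p i t <> p j t)
    (hBPE : BPE e tl hd p)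
    (Q : 'M[R]_(n * d)) (S : 'M[R]_(n * d + n * d)) (hQ : pdmx Q) (hS : pdmx S)
    (kappa : R) (hkappa : 1 / 2 <= kappa)
    (M : R -> 'M[R]_(n * d + n * d)) (hM : riccati_solution tl hd p Q S M) :
  globally_exponentially_stable
    (fun t0 : R => [set delta | exists ph vh : 'I_n -> R -> 'cV[R]_d,
       observer_solution tl hd p (gain tl hd p kappa Q M) v u t0 ph vh
       /\ delta = estimation_error p v ph vh]).

Proof.
have n0 : (0 < n)%N by apply: leq_trans hn2.
have [conn [T [mu [T0 mu0 hT]]]] := hBPE.
have [qs qcoer] := pdmx_coercive hQ => cQ.
have [s0 s00 cS] := pdmx_coercive hS.
have [b b0 hb] := bearing_laplacian_bounded (R := R) d tl hd.
pose LB s := bearing_laplacian tl hd (fun i => p i s).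
pose P s := LB s + sysC1 n d.
have pe k t : 0 <= t -> p (tl k) t <> p (hd k) t.
  by have [he' _ _] := hedges; exact: hbearings (he' k).
have cp l : mcont_from0 (p l) by apply: mcont_deriv => t; exact: hp.
have cL : mcont_from0 LB by exact: mcont_bearing_laplacian.
have cP : mcont_from0 P by apply: mcontD => //; exact: mcont_cst.
have bP t : 0 <= t -> entries_le (P t) b by move=> _; exact: hb.
have [Pi0 dPi0] := mx_primitive cL.
(* A primitive of [P]: the constant leader term contributes [s C1], written in the shape expected by
   [deriv_from_affine]. *)
pose Pi s := Pi0 s + (0 + (s - 0) *: sysC1 n d).
have dPi t : 0 <= t -> deriv_from 0 Pi t (P t).
  by move=> ht; apply: deriv_fromD; [exact: dPi0|exact: deriv_from_affine].
have [c c0 hc] := pdmx_coercive (leader_laplacian_pdmx d n0 mu0 hedges conn).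
(* Over a window, [L_B + C1] integrates to at least [T (mu L + C1)], whose coercivity constant is
   [T c]. Thus [c] replaces [mu] in the Gramian estimate. *)
have excite t : 0 <= t -> coercive (Pi (t + T) - Pi t) (T * c).
  move=> ht x; have tT : t < t + T by rewrite ltrDl.
  have [_ /(_ x)] := hT t ht.
  rewrite (mxintegral_primitive cL dPi0 ht tT) quadE mulmxBl dotBr -!scalemxAl !dotZr.
  have := hc x; rewrite mulmxDl dotDr -scalemxAl dotZr.
  have -> : Pi (t + T) - Pi t = (Pi0 (t + T) - Pi0 t) + T *: sysC1 n d.
    by rewrite /Pi; mxmodule.
  rewrite [in X in _ -> _ -> X]mulmxDl dotDr -scalemxAl dotZr.
  set l := mu * _; set w := dot x ((_ - _) *m x); set z := dot x (sysC1 n d *m x).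
  rewrite subr_ge0 ler_pdivlMl // => h1 h2.
  have := ler_wpM2l (ltW T0) h1; rewrite /l in h2 *; lra.
have [T2 [g [T20 g0 gram]]] := gramian_coercive b0 qcoer T0 c0 cP bP cQ dPi excite.
pose C t : 'M[R]_(n * d, n * d + n * d) := row_mx (P t) 0.
pose D t := (C t)^T *m Q *m C t.
have sD t : 0 <= t -> (D t)^T = D t.
  by move=> _; rewrite /D !trmx_mul trmxK hQ.1 mulmxA.
have pD t : 0 <= t -> psd_form (D t).
  by move=> _ x; rewrite /D -!mulmxA dot_mulT; exact: pdmx_form.
have [qb qb0 hqb] := entries_exists Q.
have bC t : 0 <= t -> entries_le (C t) b.
  move=> ht i j; rewrite /C mxE; case: splitP => l _; first exact: bP.
  by rewrite mxE normr0.
pose bD := (b * qb *+ (n * d)) * b *+ (n * d).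
have bD0 : 0 <= bD by rewrite /bD mulrn_wge0 // mulr_ge0 // mulrn_wge0 // mulr_ge0.
have hbD t : 0 <= t -> entries_le (D t) bD.
  move=> ht; apply: entries_leM (bC t ht); apply: entries_leM => //.
  exact: entries_le_tr (bC t ht).
have [M0 hM'] := hM.
have dM t : 0 <= t -> deriv_from 0 M t
    (sysA n d *m M t + M t *m (sysA n d)^T - M t *m D t *m M t + S).
  by move=> ht; have := hM' t ht; rewrite /D !mulmxA.
have A2 : sysA n d *m sysA n d = 0 :> 'M[R]_(n * d + n * d).
  by rewrite /sysA mulmx_block !mul0mx !mulmx0 !addr0 block_mx_const.
have [mb mb0 hmb] := riccati_upper sD pD bD0 hbD hS.1 M0 dM A2 T20 g0 gram.
have [K K0 decay] := observer_decay sD pD bD0 hbD hS.1 s00 cS M0 dM mb0 hmb hkappa.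
(* The decay estimate concerns the squared norm; taking roots halves the rate. *)
exists (Num.sqrt K), (s0 / mb / 2); split; first by rewrite sqrtr_gt0.
  by rewrite !divr_gt0.
move=> t0 delta t00 [ph [vh [obs ->]]] t t0t.
apply: enorm_exp_decay => //; apply: decay => // s hs.
exact: (estimation_error_ode (M := M) t00 hp hv obs hs).
Qed.
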